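(* Let $\Omega=dx_1\wedge dx_2$ on $\mathbb R^2$, and consider the following map-germs $A:(\mathbb R^2,0)\to(\mathrm{Sym}_3,O_3)$ (all signs $\pm$ independent): 1. $\begin{pmatrix} x_1 & 0 & 0 \\ 0 & x_2 & 0 \\ 0 & 0 & x_1-x_2 \end{pmatrix}$; 2. $\begin{pmatrix} x_1 & 0 & 0 \\ 0 & x_2 & 0 \\ 0 & 0 & \pm(x_1+x_2) \end{pmatrix}$; 3. $\begin{pmatrix} \pm x_1 & 0 & 0 \\ 0 & x_1 & x_2 \\ 0 & x_2 & -x_1 \end{pmatrix}$; 4. $\begin{pmatrix} \pm x_2^{\ell_1} & x_1 & 0 \\ x_1 & \pm x_2^{\ell_2} & 0 \\ 0 & 0 & x_2 \end{pmatrix}$, $\ell_1\ge\ell_2\ge1$, $\ell_1\ge2$; 5. $\begin{pmatrix} x_1 & x_2^\ell & 0 \\ x_2^\ell & x_1 & 0 \\ 0 & 0 & x_2 \end{pmatrix}$, $\ell\ge2$; 6. $\begin{pmatrix} 0 & x_2 & x_1 \\ x_2 & x_1 & 0 \\ x_1 & 0 & \pm x_2^2 \end{pmatrix}$; 7. $\begin{pmatrix} 0 & x_2 & x_1 \\ x_2 & x_1 & 0 \\ x_1 & 0 & x_1x_2 \end{pmatrix}$; 8. $\begin{pmatrix} x_2 & x_1 & 0 \\ x_1 & \pm x_2^2 & 0 \\ 0 & 0 & x_1 \end{pmatrix}$; 9. $\begin{pmatrix} 0 & x_2 & x_1 \\ x_2 & x_1 & 0 \\ x_1 & 0 & x_2^3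 \end{pmatrix}$; 10. $\begin{pmatrix} x_2 & x_1 & 0 \\ x_1 & 0 & x_2^2 \\ 0 & x_2^2 & x_1 \end{pmatrix}$. If $A$ is one of the germs 1, 2, 3, 4, 6, then every $B\in C^\infty(\mathbb R^2,\mathrm{Sym}_3)$ that is $\mathcal G$-equivalent to $A$ is volume-preserving equivalent to $A$. If $A$ is one of the germs 5, 7, 8, 9, 10, then the $\mathcal G$-equivalence class of $A$ splits into exactly two volume-preserving equivalence classes: setting $\bar A(x_1,x_2)=A(-x_1,x_2)$, the germs $A$ and $\bar A$ are not volume-preserving equivalent, and every $B\in C^\infty(\mathbb R^2,\mathrm{Sym}_3)$ that is $\mathcal G$-equivalent to $A$ is volume-preserving equivalent to $A$ or to $\bar A$.
   Context: $\mathrm{Sym}_n$ and $\mathrm{GL}_n$ are the real symmetric and the real invertible $n\times n$ matrices, $O_n$ the zero matrix; $C^\infty(\mathbb R^r,S)$ is the space of smooth map-germs at $0\in\mathbb R^r$ with values in $S$. $A,B\in C^\infty(\mathbb R^r,\mathrm{Sym}_n)$ are $\mathcal G$-equivalent if $B=X^T(A\circ\Phi)X$ for some diffeomorphism-germ $\Phi:(\mathbb R^r,0)\to(\mathbb R^r,0)$ and some $X\in C^\infty(\mathbb R^r,\mathrm{GL}_n)$; they are volume-preserving (unimodular) equivalent if moreover $\Phi$ can be chosen with $\Phi^*\Omega=\Omega$. *)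

(* Defs.v *)
From HB Require Import structures.
From mathcomp Require Import all_boot all_order all_algebra.
From mathcomp Require Import all_classical all_reals all_analysis.

Set Implicit Arguments.
Unset Strict Implicit.
Unset Printing Implicit Defensive.

Import Order.TTheory GRing.Theory Num.Theory.
Import numFieldNormedType.Exports.

Local Open Scope classical_set_scope.
Local Open Scope ring_scope.

(* A map-germ at the origin is represented by a total function whose values
   away from the origin are irrelevant: every condition below is imposed on a
   neighbourhood of 0 only, and equality of germs is eventual equality. *)

(* [f] is C^k on the open set [U]: the differential, tested against each fixed
   vector, is C^(k-1). *)
Fixpoint Ck_on (R : realType) (V W : normedModType R) (k : nat) (U : set V)
    (f : V -> W) : Prop :=
  match k with
  | 0 => forall x, U x -> {for x, continuous f}
  | k'.+1 => (forall x, U x -> differentiable f x)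
             /\ (forall v : V, Ck_on k' U (fun x => 'd f x v))
  end.

(* The neighbourhood does not depend on the order of differentiation. *)
Definition smooth_germ (R : realType) (V W : normedModType R) (f : V -> W)
    : Prop :=
  exists U : set V, open_nbhs 0 U /\ forall k, Ck_on k U f.

Definition diffeo_germ (R : realType) (r : nat)
    (Phi : 'rV[R]_r -> 'rV[R]_r) : Prop :=
  smooth_germ Phi /\ Phi 0 = 0 /\
  exists Psi : 'rV[R]_r -> 'rV[R]_r,
    [/\ smooth_germ Psi, Psi 0 = 0,
        \forall x \near (0 : 'rV[R]_r), Psi (Phi x) = x
      & \forall x \near (0 : 'rV[R]_r), Phi (Psi x) = x].

(* C^oo(R^r, Sym_n) *)
Definition sym_germ (R : realType) (r n : nat)
    (A : 'rV[R]_r -> 'M[R]_n) : Prop :=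
  smooth_germ A /\ \forall x \near (0 : 'rV[R]_r), (A x)^T = A x.

(* C^oo(R^r, GL_n) *)
Definition GL_germ (R : realType) (r n : nat)
    (X : 'rV[R]_r -> 'M[R]_n) : Prop :=
  smooth_germ X /\ \forall x \near (0 : 'rV[R]_r), X x \in unitmx.

(* B = X^T (A o Phi) X as germs at 0 *)
Definition G_related (R : realType) (r n : nat)
    (Phi : 'rV[R]_r -> 'rV[R]_r) (X A B : 'rV[R]_r -> 'M[R]_n) : Prop :=
  \forall x \near (0 : 'rV[R]_r), B x = (X x)^T *m A (Phi x) *m X x.

Definition G_equiv (R : realType) (r n : nat)
    (A B : 'rV[R]_r -> 'M[R]_n) : Prop :=
  exists (Phi : 'rV[R]_r -> 'rV[R]_r) (X : 'rV[R]_r -> 'M[R]_n),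
    [/\ diffeo_germ Phi, GL_germ X & G_related Phi X A B].

Definition form1 (R : realType) (r : nat) := 'rV[R]_r -> 'rV[R]_r -> R.
Definition form2 (R : realType) (r : nat) :=
  'rV[R]_r -> 'rV[R]_r -> 'rV[R]_r -> R.

Definition dx (R : realType) (r : nat) (i : 'I_r) : form1 R r :=
  fun _ v => v 0 i.

Definition wedge (R : realType) (r : nat) (a b : form1 R r) : form2 R r :=
  fun x u v => a x u * b x v - a x v * b x u.

Definition pullback (R : realType) (r : nat) (Phi : 'rV[R]_r -> 'rV[R]_r)
    (w : form2 R r) : form2 R r :=
  fun x u v => w (Phi x) ('d Phi x u) ('d Phi x v).

Definition Omega (R : realType) : form2 R 2 := wedge (@dx R 2 0) (@dx R 2 1).

Definition vol_equiv (R : realType) (n : nat)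
    (A B : 'rV[R]_2 -> 'M[R]_n) : Prop :=
  exists (Phi : 'rV[R]_2 -> 'rV[R]_2) (X : 'rV[R]_2 -> 'M[R]_n),
    [/\ diffeo_germ Phi, GL_germ X, G_related Phi X A B
      & \forall x \near (0 : 'rV[R]_2), pullback Phi (@Omega R) x = @Omega R x].

Definition mx3 (R : realType) (rows : seq (seq R)) : 'M[R]_3 :=
  \matrix_(i, j) (nth [::] rows i)`_j.

Definition sgn (R : realType) (s : bool) : R := (-1) ^+ s.

Section NormalForms.
Variable R : realType.
Implicit Types x : 'rV[R]_2.

Local Notation "x '_1'" := (x 0 0) (at level 2, format "x '_1'").
Local Notation "x '_2'" := (x 0 1) (at level 2, format "x '_2'").

Definition germ1 x := mx3 [:: [:: x _1; 0;    0          ];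
                              [:: 0;    x _2; 0          ];
                              [:: 0;    0;    x _1 - x _2]].

Definition germ2 (s : bool) x :=
  mx3 [:: [:: x _1; 0;    0                       ];
          [:: 0;    x _2; 0                       ];
          [:: 0;    0;    sgn R s * (x _1 + x _2) ]].

Definition germ3 (s : bool) x :=
  mx3 [:: [:: sgn R s * x _1; 0;    0      ];
          [:: 0;              x _1; x _2   ];
          [:: 0;              x _2; - x _1 ]].

Definition germ4 (s1 s2 : bool) (l1 l2 : nat) x :=
  mx3 [:: [:: sgn R s1 * x _2 ^+ l1; x _1;                  0    ];
          [:: x _1;                  sgn R s2 * x _2 ^+ l2; 0    ];
          [:: 0;                     0;                     x _2 ]].

Definition germ5 (l : nat) x :=
  mx3 [:: [:: x _1;      x _2 ^+ l; 0    ];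
          [:: x _2 ^+ l; x _1;      0    ];
          [:: 0;         0;         x _2 ]].

Definition germ6 (s : bool) x :=
  mx3 [:: [:: 0;    x _2; x _1                ];
          [:: x _2; x _1; 0                   ];
          [:: x _1; 0;    sgn R s * x _2 ^+ 2 ]].

Definition germ7 x := mx3 [:: [:: 0;    x _2; x _1        ];
                              [:: x _2; x _1; 0           ];
                              [:: x _1; 0;    x _1 * x _2 ]].

Definition germ8 (s : bool) x :=
  mx3 [:: [:: x _2; x _1;                 0    ];
          [:: x _1; sgn R s * x _2 ^+ 2;  0    ];
          [:: 0;    0;                    x _1 ]].

Definition germ9 x := mx3 [:: [:: 0;    x _2; x _1      ];
                              [:: x _2; x _1; 0         ];
                              [:: x _1; 0;    x _2 ^+ 3 ]].

Definition germ10 x := mx3 [:: [:: x _2; x _1;      0         ];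
                               [:: x _1; 0;         x _2 ^+ 2 ];
                               [:: 0;    x _2 ^+ 2; x _1      ]].

Inductive unsplit_germ : ('rV[R]_2 -> 'M[R]_3) -> Prop :=
| Unsplit1 : unsplit_germ germ1
| Unsplit2 s : unsplit_germ (germ2 s)
| Unsplit3 s : unsplit_germ (germ3 s)
| Unsplit4 s1 s2 l1 l2 :
    (l2 <= l1)%N -> (1 <= l2)%N -> (2 <= l1)%N ->
    unsplit_germ (germ4 s1 s2 l1 l2)
| Unsplit6 s : unsplit_germ (germ6 s).

Inductive split_germ : ('rV[R]_2 -> 'M[R]_3) -> Prop :=
| Split5 l : (2 <= l)%N -> split_germ (germ5 l)
| Split7 : split_germ germ7
| Split8 s : split_germ (germ8 s)
| Split9 : split_germ germ9
| Split10 : split_germ germ10.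

End NormalForms.

(* x |-> A(-x_1, x_2) *)
Definition reflect1 (R : realType) (n : nat) (A : 'rV[R]_2 -> 'M[R]_n)
    : 'rV[R]_2 -> 'M[R]_n :=
  fun x => A (\row_(j < 2) (if j == 0 then - x 0 j else x 0 j)).

(* Main.v *)
Require Import Defs.
From HB Require Import structures.
From mathcomp Require Import all_boot all_order all_algebra.
From mathcomp Require Import all_classical all_reals all_analysis.
From mathcomp Require Import ring lra zify.

Set Implicit Arguments.
Unset Strict Implicit.
Unset Printing Implicit Defensive.

Import Order.TTheory GRing.Theory Num.Theory.
Import numFieldNormedType.Exports.

Local Open Scope classical_set_scope.
Local Open Scope ring_scope.

(** The Jacobian determinant of an equivalence is corrected to 1 by a symmetry of
    the normal form [A].  Each [A] is quasi-homogeneous for positive weights [w],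
    so [y |-> u(y)^w y] is such a symmetry for every positive germ [u]; writing
    [N = w1 + w2], [v = u ^ N] and [E] for the weighted Euler field, its Jacobian
    determinant is [v + (E v) / N].  Hence every positive germ [h] is attained:
    take [v(y) = N * int_0^1 t^(N-1) h(t^w y) dt].  This settles equivalences that
    preserve orientation.  The other ones are reduced to them by a linear
    symmetry of [A] of negative determinant in cases 1, 2, 3, 4, 6, and by the
    reflection that turns [A] into its mirror image in the remaining cases.

    An equivalence [Phi] between [A] and its mirror image preserves the sign of
    [det A], which is [x2 (x1^2 - x2^(2 l))] in case 5 and otherwise
    [-(x1^3 + e x1 x2^3)] or [-(x1^3 + x2^5)].  Evaluating it on curves adapted to
    the weights (with the positivity of [A] itself in case 5) determines the signs
    of the entries of [D Phi(0)] and contradicts [det D Phi(0) = 1]. *)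

(** * Differentials and smooth functions *)

(** The correcting dilation must come after [Phi], because it is a symmetry of [A] and not of [B].
    Its prescribed determinant is therefore h = det D(Phi^-1), which gives the composite the
    determinant det D Phi(x) * h(Phi x) = 1. The matrix [X] can absorb the dilation because the
    entries have degrees of the form a_i + a_j: A(u^w y) = D A(y) D with D = diag(u^(a_i)).

    An arbitrary [X] multiplies det A by a square, so only the sign of the determinant can be
    compared. In cases 7 to 10 the sign suffices. In case 5 the determinant is even in x1, so the
    identity map already preserves its sign, and the semidefiniteness of A has to be used as well.

    Only D Phi(0) is controlled, while the test curves have coordinates of different orders t^p and
    t^q. A quadratic Taylor remainder has order t^(2q), which is negligible as long as p < 2q; this
    covers both (3, 2) and (5, 3). *)

Lemma is_diff_eps (R : realType) (V W : normedModType R) (f : V -> W) x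
    (D : V -> W) :
  linear D -> continuous D ->
  (forall e, 0 < e ->
    \forall h \near (0 : V), `|f (x + h) - f x - D h| <= e * `|h|) ->
  is_diff x f D.
Proof.
move=> lD cD H.
pose M := GRing.isLinear.Build _ _ _ _ _ lD.
pose L : {linear V -> W} := HB.pack D M.
have E : f \o shift x = cst (f x) + (L : V -> W) +o_ 0 id.
  apply/eqaddoP => e e0.
  near=> h.
  rewrite [leLHS](_ : _ = `|f (x + h) - f x - D h|).
    by near: h; exact: H.
  by rewrite !fctE /= opprD addrA [h + x]addrC.
have dE := diff_unique (cD : continuous L) E.
apply: DiffDef => //.
by apply/diff_locallyP; rewrite dE.
Unshelve. all: by end_near. Qed.

Lemma diff_eps (R : realType) (V W : normedModType R) (f : V -> W) x :
  differentiable f x -> forall e, 0 < e ->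
  \forall h \near (0 : V), `|f (x + h) - f x - 'd f x h| <= e * `|h|.
Proof.
move=> /diff_locallyP[_ /eqaddoP fx] e e0.
near=> h.
have -> : f (x + h) - f x - 'd f x h =
  (f \o shift x - (cst (f x) + 'd f x)) h.
  by rewrite !fctE /= opprD addrA [h + x]addrC.
near: h; exact: fx.
Unshelve. all: by end_near. Qed.

Lemma near_add0 (R : realType) (V : normedModType R) (x : V) (A : set V) :
  nbhs x A -> \forall v \near (0 : V), A (x + v).
Proof.
have cv : (fun h : V => x + h) @ 0 --> x.
  by rewrite -[X in _ --> X]addr0; apply: cvgD; [exact: cvg_cst|exact: cvg_id].
exact: cv.
Qed.

Lemma near_is_diff (R : realType) (V W : normedModType R) (f g : V -> W) x :
  (\forall y \near x, f y = g y) -> differentiable g x ->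
  is_diff x f ('d g x).
Proof.
move=> fg dg.
apply: is_diff_eps; [exact: linearP|exact: diff_continuous|].
move=> e e0.
have fgx := nbhs_singleton fg.
have fg' := near_add0 fg.
near=> h.
rewrite fgx (near fg' h) //; near: h; exact: diff_eps dg _ e0.
Unshelve. all: by end_near. Qed.

Lemma mx_norm_le (R : realType) m n (M : 'M[R]_(m, n)) e :
  0 <= e -> (forall i j, `|M i j| <= e) -> `|M| <= e.
Proof.
move=> e0 H; rewrite [leLHS]/Num.norm /= mx_normrE.
by apply/bigmax_leP; split=> // ij _.
Qed.

Lemma mx_norm_ge (R : realType) m n (M : 'M[R]_(m, n)) i j : `|M i j| <= `|M|.
Proof.
rewrite [leRHS]/Num.norm /= mx_normrE.
by apply/bigmax_geP; right => /=; exists (i, j).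
Qed.

Lemma is_diff_coord (R : realType) (V : normedModType R) m n
    (F D : V -> 'M[R]_(m, n)) x i j :
  is_diff x F D -> is_diff x (fun y => F y i j) (fun v => D v i j).
Proof.
move=> FD.
have c : is_diff (F x) (fun N : 'M[R]_(m, n) => N i j : R) (fun N => N i j).
  have @f : {linear 'M[R]_(m, n) -> R}.
    by exists (fun N : 'M[R]_(_, _) => N i j); do 2![eexists];
       do ?[constructor]; rewrite ?mxE// => ? *; rewrite ?mxE//; move=> ?;
       rewrite !mxE.
  apply: DiffDef; first exact: differentiable_coord.
  by rewrite (_ : (fun _ => _) = f) // diff_lin //; exact: coord_continuous.
exact: (is_diff_comp FD c).
Qed.

Lemma is_diff_mx (R : realType) (V : normedModType R) m n
    (F D : V -> 'M[R]_(m, n)) x :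
  (forall i j, is_diff x (fun y => F y i j) (fun v => D v i j)) ->
  is_diff x F D.
Proof.
move=> H.
have dF : differentiable F x.
  have -> : F = \sum_i \sum_j (fun y => F y i j *: delta_mx i j : 'M[R]_(m, n)).
    apply/funext => y; rewrite fct_sumE {1}[F y]matrix_sum_delta.
    by apply: eq_bigr => i _; rewrite fct_sumE.
  apply: differentiable_sum => i; apply: differentiable_sum => j.
  by apply: differentiableZl; have [] := H i j.
apply: DiffDef => //; apply/funext => v; apply/matrixP => i j.
have [_ E] := is_diff_coord i j (differentiableP dF).
by have [_ E'] := H i j; rewrite -[LHS]/((fun v => 'd F x v i j) v) -E E'.
Qed.

Lemma is_diff_row (R : realType) (V : normedModType R) n
    (F D : V -> 'rV[R]_n) x :
  (forall i, is_diff x (fun y => F y 0 i) (fun v => D v 0 i)) ->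
  is_diff x F D.
Proof. by move=> H; apply: is_diff_mx => i j; rewrite !ord1; exact: H. Qed.

Definition smooth_on (R : realType) (V W : normedModType R) (U : set V)
  (f : V -> W) := forall k, Ck_on k U f.

Lemma smooth_on_differentiable (R : realType) (V W : normedModType R)
  (U : set V) (f : V -> W) x : smooth_on U f -> U x -> differentiable f x.
Proof. by move=> /(_ 1%N)[+ _]; apply. Qed.

Lemma smooth_on_diff (R : realType) (V W : normedModType R)
  (U : set V) (f : V -> W) v :
  smooth_on U f -> smooth_on U (fun x => 'd f x v).
Proof. by move=> sf k; have [_] := sf k.+1; apply. Qed.

Lemma open_near (T : topologicalType) (U : set T) (Q : T -> Prop) x :
  open U -> U x -> (forall y, U y -> Q y) -> \forall y \near x, Q y.
Proof.
by move=> oU Ux H; apply: filterS (open_nbhs_nbhs (conj oU Ux)) => y; exact: H.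
Qed.

(* Smoothness on [U] is the greatest class of functions that are differentiable
   on [U] and stable under directional derivatives. *)
Lemma smooth_on_coind (R : realType) (V W : normedModType R) (U : set V)
    (S : (V -> W) -> Prop) : open U ->
  (forall f, S f -> forall x, U x -> differentiable f x) ->
  (forall f v, S f ->
    exists2 g, S g & forall x, U x -> 'd f x v = g x) ->
  forall f, S f -> smooth_on U f.
Proof.
move=> oU Sd Sc f Sf k.
have dg h g x : S h -> (forall x, U x -> g x = h x) -> U x ->
    is_diff x g ('d h x).
  move=> Sh gh Ux.
  exact: (near_is_diff (open_near oU Ux gh) (Sd h Sh x Ux)).
(* The induction runs over all functions that agree on [U] with a member of [S]: a derivative is
   only known to agree with a member there. *)
suff: forall g, (forall x, U x -> g x = f x) -> Ck_on k U g by exact.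
elim: k f Sf => [|k IH] f Sf g gf.
  move=> x Ux; apply: differentiable_continuous.
  by have [] := dg _ _ _ Sf gf Ux.
split; first by move=> x Ux; have [] := dg _ _ _ Sf gf Ux.
move=> v; have [f' Sf' f'E] := Sc f v Sf.
apply: (IH _ Sf') => x Ux.
by rewrite -f'E //; have [_ ->] := dg _ _ _ Sf gf Ux.
Qed.

Lemma smooth_on_sub (R : realType) (V W : normedModType R) (U U' : set V)
    (f : V -> W) : U' `<=` U -> smooth_on U f -> smooth_on U' f.
Proof.
move=> UU sf k; elim: k f sf => [|k IH] f sf.
  by move=> x /UU Ux; exact: (sf 0%N).
split; first by move=> x /UU; exact: smooth_on_differentiable.
by move=> v; apply: IH; exact: smooth_on_diff.
Qed.

(** * Closure properties of smooth functions *)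

Section algebra_of_smooth.
Context {R : realType} {V : normedModType R}.
Variables (U : set V) (P : (V -> R) -> Prop).
Hypothesis oU : open U.

(** [P] holds functions whose smoothness is still to be proved. Once their derivatives are
    expressions in [P] and in known smooth functions, [smooth_on_coind] applies to the whole
    algebra, so that an equation such as DG = (DF o G)^-1 yields smoothness without induction on the
    order. Taking [P] empty gives the plain closure properties. *)
Inductive smooth_alg : (V -> R) -> Prop :=
| alg_base f : P f -> smooth_alg f
| alg_smooth f : smooth_on U f -> smooth_alg f
| alg_cst c : smooth_alg (fun=> c)
| alg_add f g : smooth_alg f -> smooth_alg g -> smooth_alg (fun x => f x + g x)
| alg_mul f g : smooth_alg f -> smooth_alg g -> smooth_alg (fun x => f x * g x)
| alg_inv f : smooth_alg f -> (forall x, U x -> f x != 0) ->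
    smooth_alg (fun x => (f x)^-1)
| alg_pow c f : smooth_alg f -> (forall x, U x -> 0 < f x) ->
    smooth_alg (fun x => f x `^ c)
| alg_comp n (W : set 'rV[R]_n) (f : 'rV[R]_n -> R) (g : V -> 'rV[R]_n) :
    open W -> smooth_on W f -> (forall x, U x -> W (g x)) ->
    (forall i, smooth_alg (fun x => g x 0 i)) ->
    smooth_alg (fun x => f (g x)).

Hypothesis Pd : forall f, P f -> forall x, U x -> differentiable f x.
Hypothesis Pc : forall f v, P f ->
  exists2 g, smooth_alg g & forall x, U x -> 'd f x v = g x.

Lemma alg_sum (I : Type) (r : seq I) (F : I -> V -> R) :
  (forall i, smooth_alg (F i)) -> smooth_alg (fun x => \sum_(i <- r) F i x).
Proof.
move=> HF; elim: r => [|i r IH].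
  rewrite (_ : (fun _ => _) = fun=> 0); first exact: alg_cst.
  by apply/funext => x; rewrite big_nil.
rewrite (_ : (fun _ => _) = fun x => F i x + \sum_(j <- r) F j x).
  exact: alg_add.
by apply/funext => x; rewrite big_cons.
Qed.

Lemma smooth_alg_diff f : smooth_alg f ->
  (forall x, U x -> differentiable f x) /\
  (forall v, exists2 g, smooth_alg g & forall x, U x -> 'd f x v = g x).
Proof.
elim=> {f} [f Pf|f sf|c|f g _ [df cf] _ [dg cg]|f g sf [df cf] sg [dg cg]
  |f sf [df cf] f0|c f sf [df cf] f0|n W f g oW sf UW sg IH].
- by split; [exact: Pd|move=> v; exact: Pc].
- split=> [x|v]; first exact: smooth_on_differentiable.
  by exists (fun x => 'd f x v) => //; apply: alg_smooth; exact: smooth_on_diff.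
- split=> [x _|v]; first exact: differentiable_cst.
  by exists (fun=> 0) => [|x _]; [exact: alg_cst|rewrite diff_cst].
- split=> [x Ux|v]; first by apply: differentiableD; [exact: df|exact: dg].
  have [f' sf' f'E] := cf v; have [g' sg' g'E] := cg v.
  exists (fun x => f' x + g' x) => [|x Ux]; first exact: alg_add.
  by rewrite -f'E // -g'E // diffD //; [exact: df|exact: dg].
- split=> [x Ux|v]; first by apply: differentiableM; [exact: df|exact: dg].
  have [f' sf' f'E] := cf v; have [g' sg' g'E] := cg v.
  exists (fun x => f x * g' x + g x * f' x) => [|x Ux].
    by apply: alg_add; apply: alg_mul.
  by rewrite -f'E // -g'E // diffM //; [exact: df|exact: dg].
- split=> [x Ux|v]; first by apply: differentiableV; [exact: df|exact: f0].
  have [f' sf' f'E] := cf v.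
  exists (fun x => - 1 * ((f x)^-1 * (f x)^-1) * f' x) => [|x Ux].
    by apply: alg_mul => //; apply: alg_mul; [exact: alg_cst|];
      apply: alg_mul; apply: alg_inv.
  rewrite -f'E // diffV ?f0 //; last exact: df.
  rewrite mulN1r -invfM -expr2 //.
- have dp x : U x -> is_diff x (fun x => f x `^ c)
      (fun v => c * f x `^ c * (f x)^-1 * 'd f x v).
    move=> Ux; have fx0 := f0 x Ux.
    have [d1 E1] := is_derive1_powR c fx0.
    have dd : is_diff (f x) (fun t : R => t `^ c)
        (fun t => t *: (c * f x `^ (c - 1))).
      apply: DiffDef; first exact/derivable1_diffP.
      by rewrite deriv1E // derive1E E1.
    have := is_diff_comp (differentiableP (df x Ux)) dd.
    congr (is_diff _ _ _); apply/funext => v /=.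
    rewrite powRB ?(gt_eqF fx0) ?implybT // powRr1 ?(ltW fx0) //.
    by rewrite [LHS]mulrC !mulrA.
  split=> [x /dp[]|v] //.
  have [f' sf' f'E] := cf v.
  exists (fun x => c * f x `^ c * (f x)^-1 * f' x) => [|x Ux].
    apply: alg_mul => //; apply: alg_mul; last first.
      by apply: alg_inv => // x /f0; rewrite lt0r => /andP[].
    by apply: alg_mul; [exact: alg_cst|exact: alg_pow].
  by rewrite -f'E //; have [_ ->] := dp x Ux.
- have dg x : U x -> is_diff x g (fun v => \row_i 'd (fun y => g y 0 i) x v).
    move=> Ux; apply: is_diff_row => i.
    have := differentiableP ((IH i).1 x Ux).
    by congr (is_diff _ _ _); apply/funext => v; rewrite mxE.
  have dfg x : U x -> is_diff x (fun x => f (g x))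
      (fun v => \sum_i 'd (fun y => g y 0 i) x v * 'd f (g x) (delta_mx 0 i)).
    move=> Ux.
    have df : differentiable f (g x).
      by apply: smooth_on_differentiable sf _; exact: UW.
    have := is_diff_comp (dg x Ux) (differentiableP df).
    congr (is_diff _ _ _); apply/funext => v /=.
    rewrite [X in 'd f (g x) X]row_sum_delta linear_sum.
    by apply: eq_bigr => i _; rewrite linearZ /= mxE.
  split=> [x /dfg[]|v] //.
  have H i : exists g', smooth_alg g' /\
      forall x, U x -> 'd (fun y => g y 0 i) x v = g' x.
    by have [g' ? ?] := (IH i).2 v; exists g'.
  have /choice[g' g'P] := H.
  exists (fun x => \sum_i g' i x * 'd f (g x) (delta_mx 0 i)) => [|x Ux].
    apply: alg_sum => i; apply: alg_mul; first exact: (g'P i).1.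
    by apply: (alg_comp (f := fun y => 'd f y (delta_mx 0 i)) oW) => //;
      exact: smooth_on_diff.
  have [_ ->] := dfg x Ux; apply: eq_bigr => i _.
  by rewrite (g'P i).2.
Qed.

Lemma smooth_alg_smooth f : smooth_alg f -> smooth_on U f.
Proof.
move=> sf; apply: (smooth_on_coind oU _ _ sf).
- by move=> g /smooth_alg_diff[].
- by move=> g v /smooth_alg_diff[_]; apply.
Qed.

End algebra_of_smooth.

Lemma smooth_on_coord (R : realType) (V : normedModType R) m n (U : set V)
    (F : V -> 'M[R]_(m, n)) i j :
  open U -> smooth_on U F -> smooth_on U (fun x => F x i j).
Proof.
move=> oU sF.
pose S (f : V -> R) := exists2 G : V -> 'M[R]_(m, n), smooth_on U G & f = fun x => G x i j.
apply: (@smooth_on_coind _ _ _ _ S) => //; last by exists F.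
- move=> _ [G sG ->] x Ux.
  by have [] := is_diff_coord i j (differentiableP (smooth_on_differentiable sG Ux)).
- move=> _ v [G sG ->]; exists (fun x => 'd G x v i j).
    by exists (fun x => 'd G x v) => //; exact: smooth_on_diff.
  move=> x Ux.
  by have [_ ->] := is_diff_coord i j (differentiableP (smooth_on_differentiable sG Ux)).
Qed.

Lemma smooth_on_mx (R : realType) (V : normedModType R) m n (U : set V)
    (F : V -> 'M[R]_(m, n)) :
  open U -> (forall i j, smooth_on U (fun x => F x i j)) -> smooth_on U F.
Proof.
move=> oU sF.
pose S (F : V -> 'M[R]_(m, n)) := forall i j, smooth_on U (fun x => F x i j).
have dS G x : S G -> U x ->
    is_diff x G (fun v => \matrix_(i, j) 'd (fun y => G y i j) x v).
  move=> SG Ux; apply: is_diff_mx => i j.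
  have := differentiableP (smooth_on_differentiable (SG i j) Ux).
  by congr (is_diff _ _ _); apply/funext => v; rewrite mxE.
apply: (@smooth_on_coind _ _ _ _ S) => //.
- by move=> G SG x Ux; have [] := dS G x SG Ux.
- move=> G v SG; exists (fun x => \matrix_(i, j) 'd (fun y => G y i j) x v).
    move=> i j; rewrite (_ : (fun _ => _) = fun x => 'd (fun y => G y i j) x v).
      exact: smooth_on_diff.
    by apply/funext => x; rewrite mxE.
  by move=> x Ux; have [_ ->] := dS G x SG Ux.
Qed.

Section alg_closure.
Context {R : realType} {V : normedModType R}.
Variables (U : set V) (P : (V -> R) -> Prop).

Lemma alg_prod (I : Type) (r : seq I) (F : I -> V -> R) :
  (forall i, smooth_alg U P (F i)) ->
  smooth_alg U P (fun x => \prod_(i <- r) F i x).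
Proof.
move=> HF; elim: r => [|i r IH].
  rewrite (_ : (fun _ => _) = fun=> 1); first exact: alg_cst.
  by apply/funext => x; rewrite big_nil.
rewrite (_ : (fun _ => _) = fun x => F i x * \prod_(j <- r) F j x).
  exact: alg_mul.
by apply/funext => x; rewrite big_cons.
Qed.

Lemma alg_det n (F : V -> 'M[R]_n) :
  (forall i j, smooth_alg U P (fun x => F x i j)) ->
  smooth_alg U P (fun x => \det (F x)).
Proof.
move=> HF; rewrite /determinant; apply: alg_sum => s.
by apply: alg_mul; [exact: alg_cst|exact: alg_prod].
Qed.

(** Cramer's rule, written out because [invmx] branches on invertibility, which is available on [U]
    only. *)
Lemma alg_invmx n (F : V -> 'M[R]_n) :
  (forall i j, smooth_alg U P (fun x => F x i j)) ->
  (forall x, U x -> F x \in unitmx) ->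
  forall i j, smooth_alg U P (fun x => (\det (F x))^-1 * \adj (F x) i j).
Proof.
move=> HF uF i j.
apply: alg_mul.
  apply: alg_inv; first exact: alg_det.
  by move=> x /uF; rewrite unitmxE unitfE.
rewrite (_ : (fun _ => _) = fun x =>
  (-1) ^+ (j + i) * \det (row' j (col' i (F x)))); last first.
  by apply/funext => x; rewrite mxE.
apply: alg_mul; first exact: alg_cst.
apply: alg_det => k l.
rewrite (_ : (fun _ => _) = fun x => F x (lift j k) (lift i l)) //.
by apply/funext => x; rewrite !mxE.
Qed.

End alg_closure.

(** * Mean value estimates and strict differentiability *)

Lemma mulmx_norm_le (R : realType) n m (v : 'rV[R]_n) (M : 'M[R]_(n, m)) :
  `|v *m M| <= (n%:R * `|M|) * `|v|.
Proof.
apply: mx_norm_le => [|i j]; first by rewrite !mulr_ge0.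
rewrite mxE (le_trans (ler_norm_sum _ _ _)) //.
rewrite -mulrA mulr_natl -[X in _ *+ X]card_ord -sumr_const.
apply: ler_sum => k _; rewrite normrM mulrC.
by apply: ler_pM => //; exact: mx_norm_ge.
Qed.

Lemma segment_MVT (R : realType) (V : normedModType R) (f : V -> R) (a b : V) :
  (forall t : R, 0 <= t <= 1 -> differentiable f (a + t *: (b - a))) ->
  exists2 t : R, 0 <= t <= 1 & f b - f a = 'd f (a + t *: (b - a)) (b - a).
Proof.
move=> df.
pose g (t : R) := f (a + t *: (b - a)).
have dg (t : R) : 0 <= t <= 1 -> is_diff t g (fun s => 'd f (a + t *: (b - a)) (s *: (b - a))).
  move=> /df dft.
  have dl : is_diff t (fun t : R => a + t *: (b - a)) (fun s => s *: (b - a)).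
    have := is_diffD (is_diff_cst a t) (is_diff_scalel t (b - a)).
    congr (is_diff _ _ _); apply/funext => s /=; by rewrite add0r.
  exact: is_diff_comp dl (differentiableP dft).
have [| |t t01] := @MVT_segment R g (fun t => 'd f (a + t *: (b - a)) (b - a)) 0 1 ler01.
- move=> t; rewrite in_itv /= => /andP[t0 t1].
  have /dg[d1 d2] : 0 <= t <= 1 by rewrite (ltW t0) (ltW t1).
by have /derivable1_diffP/derivableP := d1; rewrite deriveE // d2 scale1r.
- apply: continuous_in_subspaceT => t; rewrite inE /= in_itv /= => t01.
  by apply: differentiable_continuous; have [] := dg t t01.
rewrite /g subr0 mulr1 scale1r scale0r addr0 subrKC => E.
by exists t => //; move: t01; rewrite in_itv.
Qed.

Lemma is_diff_coord_diff (R : realType) (V : normedModType R) m n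
    (F : V -> 'M[R]_(m, n)) x v i j :
  differentiable F x -> 'd (fun y => F y i j) x v = 'd F x v i j.
Proof. by move=> dF; have [_ ->] := is_diff_coord i j (differentiableP dF). Qed.

Lemma diff_sum_coord (R : realType) (W : normedModType R) n
    (f : 'rV[R]_n -> W) p v :
  'd f p v = \sum_i v 0 i *: 'd f p (delta_mx 0 i).
Proof.
rewrite [X in 'd f p X]row_sum_delta linear_sum.
by apply: eq_bigr => i _; rewrite linearZ.
Qed.

(** [Ck_on] gives continuity of the differential against each fixed vector; expanding [v] in the
    finite standard basis makes it uniform in [v]. *)
Lemma diff_near_continuous (R : realType) n (f : 'rV[R]_n -> R) U p e :
  open U -> smooth_on U f -> U p -> 0 < e ->
  \forall d \near (0 : R)^'+, forall q q', ball p d q -> ball p d q' ->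
    forall v, `|'d f q v - 'd f q' v| <= e * `|v|.
Proof.
move=> oU sf Up e0.
(* The factor 2 pays for the comparison of [q] and [q'] through [p]; dividing by n + 1 instead of n
   keeps the denominator nonzero for n = 0. *)
pose e' := e / 2 / n.+1%:R.
have e'0 : 0 < e' by rewrite !divr_gt0.
have [G Gc GE] : exists2 G : 'I_n -> 'rV[R]_n -> R,
    (forall i, {for p, continuous (G i)}) &
    forall q v, 'd f q v = \sum_i v 0 i * G i q.
  exists (fun i q => 'd f q (delta_mx 0 i)).
    by move=> i; exact: (smooth_on_diff (delta_mx 0 i) sf 0%N) p Up.
  by move=> q v; exact: diff_sum_coord.
have H i : \forall d \near (0 : R)^'+, forall q, ball p d q ->
    `|G i p - G i q| < e'.
  have /cvgrPdist_lt /(_ e' e'0) /nbhs_ballP[d /= d0 dP] := Gc i.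
  near=> r => q pq; apply: dP.
  by apply: le_ball pq; near: r; exact: nbhs_right_le.
have {}H : \forall d \near (0 : R)^'+, forall i q, ball p d q ->
    `|G i p - G i q| < e'.
  exact: filter_forall.
near=> d => q q' pq pq' v.
have Hd : forall i q, ball p d q -> `|G i p - G i q| < e' by near: d.
have -> : 'd f q v - 'd f q' v = \sum_i v 0 i * (G i q - G i q').
  transitivity (\sum_i v 0 i * G i q - \sum_i v 0 i * G i q').
    by congr (_ - _); exact: GE.
  by rewrite -sumrB; apply: eq_bigr => i _; rewrite mulrBr.
rewrite (le_trans (ler_norm_sum _ _ _)) //.
have -> : e = \sum_(i < n.+1) (e' + e').
  by rewrite sumr_const card_ord -mulr_natr /e' -mulrDl -splitr divfK // pnatr_eq0.
rewrite big_ord_recr /= mulrDl -[leLHS]addr0 lerD //; last first.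
  by rewrite mulr_ge0 // addr_ge0 // ltW.
rewrite mulr_suml; apply: ler_sum => i _.
rewrite normrM mulrC ler_pM //; last exact: mx_norm_ge.
rewrite (le_trans (ler_distD (G i p) _ _)) // lerD //; last exact/ltW/Hd.
by rewrite distrC; exact/ltW/Hd.
Unshelve. all: by end_near. Qed.

(** The mean value theorem on the segment from [a] to [b], which stays in the convex ball where the
    differential is nearly constant. The base point [q] is free, so one radius serves all points
    near [p]; the compactness argument for radial integrals relies on this. *)
Lemma strict_diff (R : realType) n (f : 'rV[R]_n -> R) U p e :
  open U -> smooth_on U f -> U p -> 0 < e ->
  \forall d \near (0 : R)^'+, forall q a b, ball p d q -> ball p d a ->
    ball p d b -> `|f b - f a - 'd f q (b - a)| <= e * `|b - a|.
Proof.
move=> oU sf Up e0.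
have /nbhs_ballP[r /= r0 rP] := open_nbhs_nbhs (conj oU Up).
have Hc := diff_near_continuous oU sf Up e0.
near=> d => q a b pq pa pb.
have Hd : forall q q', ball p d q -> ball p d q' ->
    forall v, `|'d f q v - 'd f q' v| <= e * `|v| by near: d; exact: Hc.
have pt (t : R) : 0 <= t <= 1 -> ball p d (a + t *: (b - a)).
  move=> /andP[t0 t1]; move: pa pb; rewrite -!ball_normE /= => pa pb.
  have -> : p - (a + t *: (b - a)) = (1 - t) *: (p - a) + t *: (p - b).
    by apply/rowP => j; rewrite !mxE; ring.
  rewrite (le_lt_trans (ler_normD _ _)) // !normrZ.
  rewrite !ger0_norm ?subr_ge0 //.
  have md : Num.max `|p - a| `|p - b| < d by rewrite gt_max pa pb.
  apply: le_lt_trans md; set m := Num.max _ _.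
  have am : `|p - a| <= m by rewrite le_max lexx.
  have bm : `|p - b| <= m by rewrite le_max lexx orbT.
  nra.
have df t : 0 <= t <= 1 -> differentiable f (a + t *: (b - a)).
  move=> t01; apply: smooth_on_differentiable sf _; apply: rP.
  by apply: le_ball (pt _ t01); near: d; exact: nbhs_right_le.
have [t t01 ->] := segment_MVT df.
by apply: Hd => //; exact: pt.
Unshelve. all: by end_near. Qed.

(* Unfolding ['d] makes failing unification problems between differentials
   practically non-terminating. *)
Local Opaque diff.

(** * The inverse function theorem *)

Lemma norm_le_eq (R : numDomainType) (V : normedZmodType R) (x y : V) e :
  x = y -> `|y| <= e -> `|x| <= e.
Proof. by move=> ->. Qed.

Lemma diff_near_continuous_rv (R : realType) n m (F : 'rV[R]_n -> 'rV[R]_m)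
    U p e :
  open U -> smooth_on U F -> U p -> 0 < e ->
  \forall d \near (0 : R)^'+, forall q q', ball p d q -> ball p d q' ->
    forall v, `|'d F q v - 'd F q' v| <= e * `|v|.
Proof.
move=> oU sF Up e0.
have /nbhs_ballP[r /= r0 rP] := open_nbhs_nbhs (conj oU Up).
have H : \forall d \near (0 : R)^'+, forall (i : 'I_m) q q',
    ball p d q -> ball p d q' -> forall v,
    `|'d (fun x => F x 0 i) q v - 'd (fun x => F x 0 i) q' v| <= e * `|v|.
  apply: filter_forall => i.
  exact: diff_near_continuous oU (smooth_on_coord 0 i oU sF) Up e0.
near=> d => q q' pq pq' v.
have dU x : ball p d x -> U x.
  move=> px; apply: rP; apply: le_ball px; near: d; exact: nbhs_right_le.
have Hd : forall (i : 'I_m) q q',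
    ball p d q -> ball p d q' -> forall v,
    `|'d (fun x => F x 0 i) q v - 'd (fun x => F x 0 i) q' v| <= e * `|v|.
  by near: d; exact: H.
apply: mx_norm_le => [|j i]; first by rewrite mulr_ge0 // ltW.
rewrite ord1; apply: norm_le_eq (Hd i q q' pq pq' v).
have dd x : ball p d x -> 'd F x v 0 i = 'd (fun x => F x 0 i) x v.
  move=> px; apply/esym/is_diff_coord_diff.
  exact: smooth_on_differentiable sF (dU _ px).
rewrite mxE; congr (_ + _); first exact: dd.
by rewrite mxE; congr (- _); exact: dd.
Unshelve. all: by end_near. Qed.

Lemma strict_diff_rv (R : realType) n m (F : 'rV[R]_n -> 'rV[R]_m) U p e :
  open U -> smooth_on U F -> U p -> 0 < e ->
  \forall d \near (0 : R)^'+, forall q a b, ball p d q -> ball p d a ->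
    ball p d b -> `|F b - F a - 'd F q (b - a)| <= e * `|b - a|.
Proof.
move=> oU sF Up e0.
have /nbhs_ballP[r /= r0 rP] := open_nbhs_nbhs (conj oU Up).
have H : \forall d \near (0 : R)^'+, forall (i : 'I_m) q a b,
    ball p d q -> ball p d a -> ball p d b ->
    `|F b 0 i - F a 0 i - 'd (fun x => F x 0 i) q (b - a)| <= e * `|b - a|.
  apply: filter_forall => i.
  exact: strict_diff oU (smooth_on_coord 0 i oU sF) Up e0.
near=> d => q a b pq pa pb.
have Hd : forall (i : 'I_m) q a b,
    ball p d q -> ball p d a -> ball p d b ->
    `|F b 0 i - F a 0 i - 'd (fun x => F x 0 i) q (b - a)| <= e * `|b - a|.
  by near: d; exact: H.
apply: mx_norm_le => [|j i]; first by rewrite mulr_ge0 // ltW.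
rewrite ord1; apply: norm_le_eq (Hd i q a b pq pa pb).
rewrite mxE; congr (_ + _); first by rewrite !mxE.
rewrite mxE; congr (- _).
apply/esym/is_diff_coord_diff; apply: smooth_on_differentiable sF _.
by apply: rP; apply: le_ball pq; near: d; exact: nbhs_right_le.
Unshelve. all: by end_near. Qed.

Lemma unitmx_inj (F : fieldType) n (A : 'M[F]_n) :
  (forall v : 'rV_n, v *m A = 0 -> v = 0) -> A \in unitmx.
Proof.
move=> inj; rewrite -row_free_unit -kermx_eq0; apply/eqP/row_matrixP => i.
by rewrite row0; apply: inj; rewrite -row_mul mulmx_ker row0.
Qed.

Lemma diff_jacobian (R : realType) n m (F : 'rV[R]_n -> 'rV[R]_m) p v :
  'd F p v = v *m 'J F p.
Proof. by rewrite /jacobian mul_rV_lin1. Qed.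

Lemma mulmxr_rV_continuous (R : realType) n m (M : 'M[R]_(n, m)) :
  continuous (fun v : 'rV[R]_n => v *m M).
Proof.
move=> v; apply: (iffRL (@cvgrPdist_le R _ _ (nbhs v) _ _ _)) => e e_gt0.
pose k := n%:R * `|M| + 1.
have k0 : 0 < k by rewrite ltr_wpDl ?mulr_ge0.
apply/nbhs_ballP; exists (e / k) => /=; first by rewrite divr_gt0.
move=> u; rewrite -ball_normE /= => uv.
rewrite -mulmxBl (le_trans (mulmx_norm_le _ _)) //.
rewrite (@le_trans _ _ (k * `|v - u|)) ?ler_wpM2r // /k ?lerDl //.
by rewrite mulrC -ler_pdivlMr // ltW.
Qed.

(** Row vectors are needed as a complete normed space for [banach_fixed_point]. *)
HB.instance Definition _ (R : realType) (m n : nat) :=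
  Complete.on 'M[R]_(m, n).

Section inverse_function.
Context {R : realType} {n : nat}.
Variables (F : 'rV[R]_n -> 'rV[R]_n) (p : 'rV[R]_n) (d c : R).
Hypotheses (d0 : 0 < d) (c0 : 0 < c).
Hypothesis c_inv : forall v : 'rV[R]_n, `|v *m invmx ('J F p)| <= c * `|v|.
Hypothesis uJ : 'J F p \in unitmx.
Hypothesis strictF : forall q a b, ball p d q -> ball p d a ->
  ball p d b -> `|F b - F a - 'd F q (b - a)| <= (2 * c)^-1 * `|b - a|.

Let pp : ball p d p. Proof. exact: ballxx. Qed.

Let strictJ a b : ball p d a -> ball p d b ->
  `|F b - F a - (b - a) *m 'J F p| <= (2 * c)^-1 * `|b - a|.
Proof. by move=> pa pb; rewrite -diff_jacobian; exact: strictF. Qed.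

(** The constant (2 c)^-1 in [strictF] is chosen so that, after applying the inverse Jacobian of
    norm at most [c], the error is half of |b - a| and can be moved to the left-hand side. *)
Lemma local_inverse_lipschitz a b : ball p d a -> ball p d b ->
  `|b - a| <= 2 * c * `|F b - F a|.
Proof.
move=> pa pb; have H := strictJ pa pb.
have : `|(b - a) *m 'J F p| <= `|F b - F a| + (2 * c)^-1 * `|b - a|.
  rewrite -lerBlDl (le_trans _ H) // (le_trans (lerB_dist _ _)) //.
  by rewrite distrC.
move=> {}H; have := c_inv ((b - a) *m 'J F p); rewrite mulmxK //.
have := ler_wpM2l (ltW c0) H.
have E (z : R) : c * ((2 * c)^-1 * z) = z / 2 by field; rewrite gt_eqF.
rewrite mulrDr E.
set x := `|b - a|; set y := `|F b - F a|; lra.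
Qed.

(** Newton's iteration with the derivative frozen at [p] is a contraction of ratio 1/2. It moves the
    centre by at most c * d / (4 c) = d / 4, so it maps the closed ball of radius d / 2 into
    itself. *)
Lemma local_inverse_exists y : `|y - F p| < d / (4 * c) ->
  exists2 x, ball p d x & F x = y.
Proof.
move=> yp.
pose U0 := closed_ball_ Num.norm p (d / 2) : set 'rV[R]_n.
have sub x : U0 x -> ball p d x.
  rewrite -ball_normE /U0 /closed_ball_ /= => /le_lt_trans; apply.
  by rewrite ltr_pdivrMr // ltr_pMr // ltr1n.
pose T x := x + (y - F x) *m invmx ('J F p).
have TL a b : U0 a -> U0 b -> `|T b - T a| <= 2^-1 * `|b - a|.
  move=> /sub pa /sub pb.
  have -> : T b - T a = - (F b - F a - (b - a) *m 'J F p) *m invmx ('J F p).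
    rewrite mulNmx mulmxBl mulmxK // /T opprB !mulmxBl.
    by apply/rowP => j; rewrite !mxE; ring.
  rewrite (le_trans (c_inv _)) // normrN.
  apply: le_trans (ler_wpM2l (ltW c0) (strictJ pa pb)) _.
  by rewrite invfM mulrA mulrCA mulfV ?gt_eqF // mulr1.
have U0p : U0 p by rewrite /U0 /closed_ball_ /= subrr normr0 divr_ge0 // ltW.
have TU : {homo T : x / U0 x >-> U0 x}.
  move=> x U0x; rewrite /U0 /closed_ball_ /= -(subrKA (T p)).
  rewrite (le_trans (ler_normD _ _)) //.
  have := TL _ _ U0x U0p => h1.
  have h2 : `|p - T p| <= d / 4.
    rewrite /T opprD addrA subrr sub0r normrN (le_trans (c_inv _)) //.
    by rewrite mulrC -ler_pdivlMr // (le_trans (ltW yp)) // invfM mulrA.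
  have h3 : `|p - x| <= d / 2 by [].
  lra.
have [x U0x xE] : exists2 x, U0 x & x = T x.
  pose TF := mkfun TU.
  apply: (@banach_fixed_point _ _ U0 TF) => //.
  - have q0 : 0 <= 2^-1 :> R by rewrite invr_ge0.
    exists (NngNum q0); split => /=; first by rewrite invf_lt1 // ltr1n.
    by move=> [a b] /= [U0a U0b]; exact: TL.
  - exact: closed_closed_ball_.
  - by exists p.
exists x; first exact: sub.
have : (y - F x) *m invmx ('J F p) = 0.
  by apply: (addrI x); rewrite addr0 [RHS]xE.
move=> /(congr1 (mulmx^~ ('J F p))); rewrite mulmxKV // mul0mx => /subr0_eq.
by [].
Qed.

End inverse_function.

Theorem inverse_function_theorem (R : realType) n (F : 'rV[R]_n -> 'rV[R]_n)
    U p :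
  open U -> U p -> smooth_on U F -> 'J F p \in unitmx ->
  exists (G : 'rV[R]_n -> 'rV[R]_n) (V : set 'rV[R]_n),
    [/\ open V, V (F p), smooth_on V G, G (F p) = p
      & (forall y, V y -> F (G y) = y) /\ \forall x \near p, G (F x) = x].
Proof.
move=> oU Up sF uJ.
pose c := n%:R * `|invmx ('J F p)| + 1.
have c0 : 0 < c by rewrite ltr_wpDl ?mulr_ge0.
have c_inv (v : 'rV[R]_n) : `|v *m invmx ('J F p)| <= c * `|v|.
  rewrite (le_trans (mulmx_norm_le _ _)) //.
  by rewrite ler_wpM2r // /c lerDl.
have e0 : 0 < (2 * c)^-1 by rewrite invr_gt0 mulr_gt0.
have /nbhs_ballP[r /= r0 rP] := open_nbhs_nbhs (conj oU Up).
have [d [d0 dr] [strictF contF]] : exists2 d, 0 < d /\ d <= r &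
    (forall q a b, ball p d q -> ball p d a -> ball p d b ->
      `|F b - F a - 'd F q (b - a)| <= (2 * c)^-1 * `|b - a|) /\
    (forall q q', ball p d q -> ball p d q' ->
      forall v, `|'d F q v - 'd F q' v| <= (2 * c)^-1 * `|v|).
  have Hs := strict_diff_rv oU sF Up e0.
  have Hc := diff_near_continuous_rv oU sF Up e0.
  near (0 : R)^'+ => d; exists d; split.
  - by near: d; exact: nbhs_right_gt.
  - by near: d; exact: nbhs_right_le.
  - by near: d; exact: Hs.
  - by near: d; exact: Hc.
have dU x : ball p d x -> U x by move=> px; apply: rP; exact: le_ball px.
have pp : ball p d p := ballxx p d0.
(* A vector killed by the Jacobian at [q] satisfies |v J(p)| <= |v| / (2 c), hence |v| <= |v| /
   2. *)
have uJq q : ball p d q -> 'J F q \in unitmx.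
  move=> pq; apply: unitmx_inj => v vq.
  have h1 : `|v *m 'J F p| <= (2 * c)^-1 * `|v|.
    apply: norm_le_eq (contF p q pp pq v).
    transitivity (v *m 'J F p - 0); first exact/esym/subr0.
    congr (_ - _); first exact/esym/diff_jacobian.
    exact: etrans (esym vq) (esym (diff_jacobian _ _ _)).
  have := c_inv (v *m 'J F p); rewrite mulmxK // => h2.
  have h3 := ler_wpM2l (ltW c0) h1.
  have E (z : R) : c * ((2 * c)^-1 * z) = z / 2 by field; rewrite gt_eqF.
  rewrite E in h3.
  apply/eqP; rewrite -normr_le0.
  by move: (le_trans h2 h3); set z := `|v|; lra.
have inj := local_inverse_lipschitz d0 c0 c_inv uJ strictF.
have sur := local_inverse_exists d0 c0 c_inv uJ strictF.
(* The default [p] is returned only where there is no preimage in the ball, hence never on [V]. *)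
pose G y := xget p [set x | ball p d x /\ F x = y].
pose V := ball (F p) (d / (4 * c)).
have r'0 : 0 < d / (4 * c) by rewrite divr_gt0 ?mulr_gt0.
have GV y : V y -> ball p d (G y) /\ F (G y) = y.
  move=> Vy; have /sur[x px xE] : `|y - F p| < d / (4 * c).
    by move: Vy; rewrite /V -ball_normE /= distrC.
  exact: (@xgetI _ p [set x | ball p d x /\ F x = y] x (conj px xE)).
have FG x y : ball p d x -> V y -> F x = y -> G y = x.
  move=> px Vy xE; have [pG GE] := GV y Vy.
  have := inj _ _ px pG; rewrite GE xE subrr normr0 mulr0 normr_le0 subr_eq0.
  by move/eqP.
have oV : open V by exact: ball_open.
have VFp : V (F p) by exact: ballxx.
have Glip y y' : V y -> V y' -> `|G y' - G y| <= 2 * c * `|y' - y|.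
  move=> Vy Vy'; have [pG GE] := GV y Vy; have [pG' GE'] := GV y' Vy'.
  by have := inj _ _ pG pG'; rewrite GE GE'.
have cc0 : 0 < 2 * c by rewrite mulr_gt0.
have E4 (k e z : R) : 0 < k -> k * (e / k / (2 * c) * (2 * c * z)) = e * z.
  by move=> k0; field; rewrite !gt_eqF.
have dG y : V y -> is_diff y G (fun v => v *m invmx ('J F (G y))).
  move=> Vy; have [pG GE] := GV y Vy; have uG := uJq _ pG.
  apply: is_diff_eps.
  - by move=> a u v; rewrite mulmxDl scalemxAl.
  - exact: mulmxr_rV_continuous.
  move=> e e_gt0.
  (* [k] bounds the inverse Jacobian at [G y] and 2 c is the Lipschitz constant of [G]; dividing [e]
     by both makes the final bound exactly e * |h|. *)
  pose k := n%:R * `|invmx ('J F (G y))| + 1.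
  have k0 : 0 < k by rewrite ltr_wpDl ?mulr_ge0.
  have e'0 : 0 < e / k / (2 * c) by rewrite !divr_gt0.
  have := diff_eps (smooth_on_differentiable sF (dU _ pG)) e'0.
  move=> /nbhs_ballP[s /= s0 sP].
  have /nbhs_ballP[t /= t0 tP] := open_nbhs_nbhs (conj oV Vy).
  apply/nbhs_ballP; exists (Num.min t (s / (2 * c))).
    by rewrite /= lt_min t0 divr_gt0.
  move=> h; rewrite -ball_normE /= sub0r normrN lt_min => /andP[ht hs].
  have Vyh : V (y + h).
    by apply: tP; rewrite -ball_normE /= opprD addNKr normrN.
  have [pGh GhE] := GV _ Vyh.
  pose w := G (y + h) - G y.
  have wh : `|w| <= 2 * c * `|h|.
    by have := Glip _ _ Vy Vyh; rewrite addrAC subrr add0r.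
  have /sP : ball 0 s w.
    rewrite -ball_normE /= sub0r normrN (le_lt_trans wh) //.
    by rewrite mulrC -ltr_pdivlMr.
  rewrite diff_jacobian /w [G y + _]addrC subrK GhE GE -/w => H.
  have -> : w - h *m invmx ('J F (G y)) =
    - ((y + h - y - w *m 'J F (G y)) *m invmx ('J F (G y))).
    rewrite mulmxBl mulmxK // [y + h]addrC addrK opprB.
    by [].
  rewrite normrN (le_trans (mulmx_norm_le _ _)) //.
  rewrite (@le_trans _ _ (k * (e / k / (2 * c) * `|w|))) //.
    apply: ler_pM; [by rewrite mulr_ge0|exact: normr_ge0|
      by rewrite /k lerDl|exact: H].
  rewrite (@le_trans _ _ (k * (e / k / (2 * c) * (2 * c * `|h|)))) //.
    by apply: (ler_wpM2l (ltW k0)); apply: (ler_wpM2l (ltW e'0)).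
  by rewrite E4.
(* Bootstrap: the partial derivatives of [G] are rational expressions in the entries of the smooth
   map JF composed with [G], so the coordinates of [G] can serve as the class [P]. *)
have sG : smooth_on V G.
  apply: smooth_on_mx => // i j; rewrite ord1 {i}.
  pose P (f : 'rV[R]_n -> R) := exists i, f = fun y => G y 0 i.
  have aG i : smooth_alg V P (fun y => G y 0 i) by apply: alg_base; exists i.
  have dGi y i : V y -> is_diff y (fun y => G y 0 i)
      (fun v => (v *m invmx ('J F (G y))) 0 i).
    by move=> Vy; exact: (is_diff_coord 0 i (dG y Vy)).
  apply: (@smooth_alg_smooth _ _ _ P) => //.
  - by move=> _ [i ->] y Vy; have [] := dGi y i Vy.
  - move=> _ v [i ->].
    exists (fun y => \sum_k v 0 k *
        ((\det ('J F (G y)))^-1 * \adj ('J F (G y)) k i)); last first.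
      move=> y Vy; have [_ ->] := dGi y i Vy; have [pG _] := GV y Vy.
      rewrite mxE; apply: eq_bigr => k _; rewrite /invmx uJq //.
      by rewrite mxE.
    apply: alg_sum => k; apply: alg_mul; first exact: alg_cst.
    apply: alg_invmx => [a b|y Vy]; last by apply: uJq; have [] := GV y Vy.
    have -> : (fun y => 'J F (G y) a b) =
        fun y => (fun x => 'd F x (delta_mx 0 a) 0 b) (G y).
      by apply/funext => y; rewrite /jacobian /lin1_mx mxE.
    apply: (alg_comp (f := fun x => 'd F x (delta_mx 0 a) 0 b) oU) => //.
      by apply: smooth_on_coord => //; exact: smooth_on_diff.
    by move=> y Vy; apply: dU; have [] := GV y Vy.
exists G, V; split => //.
- exact: FG.
split; first by move=> y /GV[].
have cF : {for p, continuous F}.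
  by apply: differentiable_continuous; exact: smooth_on_differentiable sF Up.
have h1 : \forall x \near p, V (F x).
  by apply: cF; exact: open_nbhs_nbhs.
have h2 : \forall x \near p, ball p d x by exact: nbhsx_ballx.
near=> x; apply: FG => //; near: x; [exact: h2|exact: h1].
Unshelve. all: by end_near. Qed.

(** * Weighted radial integrals *)

Definition unit_integral (R : realType) (f : R -> R) : R :=
  \int[lebesgue_measure]_(t in `[0, 1]) f t.

(** Two-sided continuity, also at the end points: the integrands live on the whole line, and
    pointwise continuity is easier to combine than continuity within the segment. *)
Definition unit_continuous (R : realType) (f : R -> R) :=
  forall t, 0 <= t <= 1 -> {for t, continuous f}.

Section unit_integral.
Variable R : realType.
Implicit Types (f g : R -> R).

Lemma unit_continuous_within f :
  unit_continuous f -> {within `[0, 1], continuous f}.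
Proof.
by move=> cf; apply: continuous_in_subspaceT => t; rewrite inE /= in_itv /=; exact: cf.
Qed.

Lemma unit_continuous_integrable f : unit_continuous f ->
  (@lebesgue_measure R).-integrable `[0, 1] (EFin \o f).
Proof.
move=> /unit_continuous_within cf.
by apply: continuous_compact_integrable => //; exact: segment_compact.
Qed.

Lemma unit_integralD f g : unit_continuous f -> unit_continuous g ->
  unit_integral (fun t => f t + g t) = unit_integral f + unit_integral g.
Proof.
by move=> cf cg; rewrite /unit_integral RintegralD //;
  exact: unit_continuous_integrable.
Qed.

Lemma unit_integralZ f r : unit_continuous f ->
  unit_integral (fun t => r * f t) = r * unit_integral f.
Proof.
by move=> cf; rewrite /unit_integral RintegralZl //;
  exact: unit_continuous_integrable.
Qed.

Lemma unit_continuous_cst (c : R) : unit_continuous (fun=> c).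
Proof. by move=> t _; exact: cvg_cst. Qed.

Lemma unit_continuousD f g : unit_continuous f -> unit_continuous g ->
  unit_continuous (fun t => f t + g t).
Proof. by move=> cf cg t t01; apply: cvgD; [exact: cf|exact: cg]. Qed.

Lemma unit_continuousM f g : unit_continuous f -> unit_continuous g ->
  unit_continuous (fun t => f t * g t).
Proof. by move=> cf cg t t01; apply: cvgM; [exact: cf|exact: cg]. Qed.

Lemma unit_continuousX n : unit_continuous (fun t : R => t ^+ n).
Proof. by move=> t _; exact: exprn_continuous. Qed.

Lemma unit_continuous_sum n (F : 'I_n -> R -> R) :
  (forall i, unit_continuous (F i)) -> unit_continuous (fun t => \sum_i F i t).
Proof.
elim: n F => [|n IH] F cF.
  rewrite (_ : (fun _ => _) = fun=> 0); first exact: unit_continuous_cst.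
  by apply/funext => t; rewrite big_ord0.
rewrite (_ : (fun _ => _) = fun t => F ord0 t + \sum_i F (lift ord0 i) t).
  by apply: unit_continuousD => //; exact: IH.
by apply/funext => t; rewrite big_ord_recl.
Qed.

Lemma unit_integral_sum n (F : 'I_n -> R -> R) :
  (forall i, unit_continuous (F i)) ->
  unit_integral (fun t => \sum_i F i t) = \sum_i unit_integral (F i).
Proof.
elim: n F => [|n IH] F cF.
  rewrite big_ord0 (_ : (fun _ => _) = fun=> 0 * 0); last first.
    by apply/funext => t; rewrite big_ord0 mul0r.
  by rewrite unit_integralZ ?mul0r //; exact: unit_continuous_cst.
rewrite big_ord_recl -IH // -unit_integralD //; last exact: unit_continuous_sum.
by congr unit_integral; apply/funext => t; rewrite big_ord_recl.
Qed.

Lemma unit_integral_norm f M : unit_continuous f ->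
  (forall t, 0 <= t <= 1 -> `|f t| <= M) -> `|unit_integral f| <= M.
Proof.
move=> cf fM; have fi := unit_continuous_integrable cf.
rewrite (le_trans (le_normr_Rintegral _ fi)) //.
have -> : M = unit_integral (fun=> M).
  rewrite /unit_integral Rintegral_cst //.
  have E : lebesgue_measure (`[0, 1]%classic : set R) = 1%:E.
    by rewrite lebesgue_measure_itv /= lte_fin ltr01 -EFinB subr0.
  transitivity (M * fine 1%:E); first by rewrite /= mulr1.
  by congr (_ * fine _); exact/esym/E.
apply: le_Rintegral => //.
- apply: (@unit_continuous_integrable (fun t => `|f t|)) => t t01.
  by apply: cvg_norm; exact: cf.
- exact: (unit_continuous_integrable (@unit_continuous_cst M)).
Qed.

Lemma unit_integral_FTC f g : unit_continuous g ->
  (forall t : R, 0 <= t <= 1 -> is_derive t 1 f (g t)) ->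
  unit_integral g = f 1 - f 0.
Proof.
move=> cg df.
rewrite /unit_integral /Rintegral (@continuous_FTC2 _ g f 0 1) //.
- exact: unit_continuous_within.
- have cf t : 0 <= t <= 1 -> {for t, continuous f}.
    move=> t01; apply/differentiable_continuous/derivable1_diffP.
    by have [] := df t t01.
  split.
  + move=> t; rewrite in_itv /= => /andP[/ltW t0 /ltW t1].
    by have [] := df t; rewrite ?t0.
  + by apply: cvg_at_right_filter; apply: cf; rewrite lexx ler01.
  + by apply: cvg_at_left_filter; apply: cf; rewrite lexx ler01.
- move=> t; rewrite in_itv /= => /andP[/ltW t0 /ltW t1].
  by rewrite derive1E; have [|_ ->] := df t; rewrite ?t0.
Qed.

End unit_integral.

Definition wscale (R : realType) n (w : 'I_n -> nat) (s : R) (x : 'rV[R]_n)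
    : 'rV[R]_n := \row_i (s ^+ w i * x 0 i).

Section radial_integral.
Context {R : realType} {n : nat}.
Variables (w : 'I_n -> nat) (r : R).
Implicit Types (h : 'rV[R]_n -> R) (x v : 'rV[R]_n) (m : nat).
Let U : set 'rV[R]_n := ball 0 r.

Let oU : open U. Proof. exact: ball_open. Qed.

Lemma wscale_norm (t : R) x : 0 <= t <= 1 -> `|wscale w t x| <= `|x|.
Proof.
move=> /andP[t0 t1]; apply: mx_norm_le => // i j; rewrite mxE.
rewrite normrM (le_trans _ (mx_norm_ge x 0 j)) //.
by rewrite ler_piMl // normrX ger0_norm // exprn_ile1.
Qed.

Lemma wscale_ball (t : R) x : 0 <= t <= 1 -> U x -> U (wscale w t x).
Proof.
rewrite /U -ball_normE /= !sub0r !normrN => t01; apply: le_lt_trans.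
exact: wscale_norm.
Qed.

Lemma wscaleD (t : R) x v : wscale w t (x + v) = wscale w t x + wscale w t v.
Proof. by apply/rowP => i; rewrite !mxE mulrDr. Qed.

Lemma is_diff_wscale (t : R) x :
  is_diff t (wscale w ^~ x)
    (fun s => s *: \row_i ((w i)%:R * t ^+ (w i).-1 * x 0 i)).
Proof.
apply: is_diff_row => i.
have h : is_derive t (1 : R) (fun s : R => wscale w s x 0 i)
    ((w i)%:R * t ^+ (w i).-1 * x 0 i).
  have -> : (fun s : R => wscale w s x 0 i) = (fun s => x 0 i *: s ^+ w i).
    by apply/funext => s; rewrite mxE mulrC.
  have h1 : is_derive t (1 : R) (fun s : R => s ^+ w i) ((w i)%:R * t ^+ (w i).-1).
    split; first exact: exprn_derivable.
    by rewrite exp_derive /GRing.scale /= mulr1.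
  apply: (is_derive_eq (is_deriveZ (x 0 i) h1)).
  by rewrite /GRing.scale /= mulrC.
have [h1 h2] := h.
apply: DiffDef; first exact/derivable1_diffP.
rewrite deriv1E // derive1E h2; apply/funext => s.
by rewrite !mxE.
Qed.

Lemma unit_continuous_wscale h m x : smooth_on U h -> U x ->
  unit_continuous (fun t => t ^+ m * h (wscale w t x)).
Proof.
move=> sh Ux; apply: unit_continuousM; first exact: unit_continuousX.
move=> t t01; apply: differentiable_continuous.
have dh : differentiable h (wscale w t x).
  by apply: smooth_on_differentiable sh _; exact: wscale_ball.
by have [] := is_diff_comp (is_diff_wscale t x) (differentiableP dh).
Qed.

(** First-order expansion uniform in [t], which is what differentiation under the integral needs.
    Strict differentiability gives one estimate for all [t] near a given [t0], and compactness of
    [0, 1] gives a single neighbourhood of [v]. *)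
Lemma wscale_uniform_diff h x e : smooth_on U h -> U x -> 0 < e ->
  \forall v \near (0 : 'rV[R]_n), forall t : R, 0 <= t <= 1 ->
    `|h (wscale w t (x + v)) - h (wscale w t x)
      - 'd h (wscale w t x) (wscale w t v)| <= e * `|v|.
Proof.
move=> sh Ux e0.
have K := (compact_near_coveringP _).1 (@segment_compact R 0 1).
pose Q v (t : R) := `|h (wscale w t (x + v)) - h (wscale w t x)
      - 'd h (wscale w t x) (wscale w t v)| <= e * `|wscale w t v|.
have {}K : \forall v \near (0 : 'rV[R]_n), `[0, 1]%classic `<=` Q v.
  apply: (K _ (nbhs (0 : 'rV[R]_n)) Q) => t0.
  rewrite /= in_itv /= => t01.
  have [d d0 dS] : exists2 d, 0 < d & forall q a b,
      ball (wscale w t0 x) d q -> ball (wscale w t0 x) d a ->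
      ball (wscale w t0 x) d b ->
      `|h b - h a - 'd h q (b - a)| <= e * `|b - a|.
    have Hs := strict_diff oU sh (wscale_ball t01 Ux) e0.
    near (0 : R)^'+ => d; exists d.
      by near: d; exact: nbhs_right_gt.
    by near: d; exact: Hs.
  have cw : \forall t \near t0 & v \near (0 : 'rV[R]_n),
      ball (wscale w t0 x) d (wscale w t (x + v)).
    have d20 : 0 < d / 2 by rewrite divr_gt0.
    have H i : nbhs ((t0 : R), (0 : 'rV[R]_n)) (fun tv : R * 'rV[R]_n =>
        `|t0 ^+ w i * x 0 i - tv.1 ^+ w i * (x 0 i + tv.2 0 i)| <= d / 2).
      have c : (fun tv : R * 'rV[R]_n => tv.1 ^+ w i * (x 0 i + tv.2 0 i))
          @ (t0, 0 : 'rV[R]_n) --> t0 ^+ w i * x 0 i.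
        apply: cvgM.
          have c1 : tv.1 @[tv --> (t0, 0 : 'rV[R]_n)] --> t0 by exact: cvg_fst.
          exact: (cvg_comp _ _ c1 (@exprn_continuous _ _ _)).
        rewrite -[X in _ --> X]addr0; apply: cvgD; first exact: cvg_cst.
        have c2 : tv.2 @[tv --> (t0, 0 : 'rV[R]_n)] --> (0 : 'rV[R]_n).
          exact: cvg_snd.
        have c3 := cvg_comp _ _ c2 (@coord_continuous _ _ _ 0 i 0).
        by rewrite mxE in c3.
      by have /cvgrPdist_le /(_ _ d20) := c.
    have {}H : nbhs ((t0 : R), (0 : 'rV[R]_n)) (fun tv : R * 'rV[R]_n =>
        forall i, `|t0 ^+ w i * x 0 i - tv.1 ^+ w i * (x 0 i + tv.2 0 i)| <= d / 2).
      have FF : Filter (nbhs ((t0 : R), (0 : 'rV[R]_n))) by exact: nbhs_filter.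
      exact: (@filter_forall (R * 'rV[R]_n)%type 'I_n _ (nbhs ((t0 : R), (0 : 'rV[R]_n))) FF H).
    have HH : nbhs ((t0 : R), (0 : 'rV[R]_n)) (fun tv : R * 'rV[R]_n =>
        ball (wscale w t0 x) d (wscale w tv.1 (x + tv.2))).
      apply: filterS H => tv Htv; rewrite -ball_normE /=.
      have d2d : d / 2 < d by rewrite ltr_pdivrMr // ltr_pMr // ltr1n.
      apply: le_lt_trans d2d; apply: mx_norm_le => [|a b]; first exact: ltW.
      by rewrite !mxE; exact: Htv.
    exact: HH.
  have cw0 : \forall t \near t0 & v \near (0 : 'rV[R]_n),
      ball (wscale w t0 x) d (wscale w t x).
    have H0 : \forall t \near t0, ball (wscale w t0 x) d (wscale w t x).
      have [dw _] := is_diff_wscale t0 x.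
      have /cvg_ballP := differentiable_continuous dw.
      exact.
    exact: (cvg_fst H0).
  apply: filterS (filterI cw cw0) => -[t v] /= [b1 b2]; rewrite /Q.
  have -> : wscale w t v = wscale w t (x + v) - wscale w t x.
    by rewrite wscaleD addrAC subrr add0r.
  exact: dS.
near=> v => t t01.
have : Q v t.
  by move: t t01; near: v; apply: filterS K => v Kv t t01; apply: Kv; rewrite /= in_itv.
move=> /le_trans; apply; apply: ler_wpM2l; first exact: ltW.
exact: wscale_norm.
Unshelve. all: by end_near. Qed.

End radial_integral.

Section radial_integral_smooth.
Context {R : realType} {n : nat}.
Variables (w : 'I_n -> nat) (r : R).
Implicit Types (h : 'rV[R]_n -> R) (x v : 'rV[R]_n) (m : nat).
Let U : set 'rV[R]_n := ball 0 r.

Let oU : open U. Proof. exact: ball_open. Qed.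

Definition radial_integral m h x :=
  unit_integral (fun t => t ^+ m * h (wscale w t x)).

Lemma diff_wscale_sum h (t : R) x v :
  'd h (wscale w t x) (wscale w t v) =
  \sum_i t ^+ w i * v 0 i * 'd h (wscale w t x) (delta_mx 0 i).
Proof.
rewrite [LHS]diff_sum_coord; apply: eq_bigr => i _.
by rewrite /wscale mxE.
Qed.

(** Differentiation under the integral: the i-th coordinate of the dilation contributes a factor
    t^(w_i), which raises the exponent by [w i]. *)
Lemma is_diff_radial_integral m h x : smooth_on U h -> U x ->
  is_diff x (radial_integral m h)
    (fun v => \sum_i v 0 i *
      radial_integral (m + w i) (fun y => 'd h y (delta_mx 0 i)) x).
Proof.
move=> sh Ux.
pose c i := radial_integral (m + w i) (fun y => 'd h y (delta_mx 0 i)) x.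
apply: is_diff_eps.
- move=> a u v; rewrite scaler_sumr -big_split /=; apply: eq_bigr => i _.
  by rewrite !mxE mulrDl /GRing.scale /= mulrA.
- have -> : (fun v : 'rV[R]_n => \sum_i v 0 i * c i) =
      (fun M : 'M[R]_(1, 1) => M 0 0) \o (fun v => v *m \col_i c i).
    apply/funext => v /=; rewrite mxE; apply: eq_bigr => i _.
    by rewrite mxE.
  move=> v; apply: continuous_comp; first exact: mulmxr_rV_continuous.
  exact: coord_continuous.
move=> e e0.
have H := wscale_uniform_diff w sh Ux e0.
have HU : \forall v \near (0 : 'rV[R]_n), U (x + v).
  exact: near_add0 (open_nbhs_nbhs (conj oU Ux)).
apply: filterS (filterI H HU) => v [Hv Uxv].
have cC i : unit_continuous
    (fun t => t ^+ (m + w i) * 'd h (wscale w t x) (delta_mx 0 i)).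
  have sd : smooth_on U (fun y => 'd h y (delta_mx 0 i)) by exact: smooth_on_diff.
  have := unit_continuous_wscale (w := w) (m := (m + w i)%N) sd Ux. exact.
have cA := unit_continuous_wscale (w := w) (m := m) sh Uxv.
have cB := unit_continuous_wscale (w := w) (m := m) sh Ux.
(* The first-order remainder is the integral of [g], and |g| <= e * |v| uniformly on [0, 1]. *)
pose g (t : R) := t ^+ m * (h (wscale w t (x + v)) - h (wscale w t x)
      - 'd h (wscale w t x) (wscale w t v)).
have cv i : unit_continuous (fun t =>
    - v 0 i * (t ^+ (m + w i) * 'd h (wscale w t x) (delta_mx 0 i))).
  by apply: unit_continuousM => //; exact: unit_continuous_cst.
have cB' : unit_continuous (fun t => - 1 * (t ^+ m * h (wscale w t x))).
  by apply: unit_continuousM => //; exact: unit_continuous_cst.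
have gE : g = fun t => (t ^+ m * h (wscale w t (x + v)) +
    - 1 * (t ^+ m * h (wscale w t x))) + \sum_i
    - v 0 i * (t ^+ (m + w i) * 'd h (wscale w t x) (delta_mx 0 i)).
  apply/funext => t; rewrite /g diff_wscale_sum mulrBr mulrBr mulN1r.
  congr (_ + _); rewrite mulr_sumr -sumrN; apply: eq_bigr => i _.
  by rewrite exprD; ring.
have cg : unit_continuous g.
  rewrite gE; apply: unit_continuousD; first exact: unit_continuousD.
  exact: unit_continuous_sum.
have -> : radial_integral m h (x + v) - radial_integral m h x -
    \sum_i v 0 i * c i = unit_integral g.
  rewrite gE unit_integralD; [|exact: unit_continuousD|exact: unit_continuous_sum].
  rewrite unit_integralD // unit_integralZ // unit_integral_sum // mulN1r.
  congr (_ + _); rewrite -sumrN; apply: eq_bigr => i _.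
  by rewrite unit_integralZ // mulNr.
apply: unit_integral_norm => // t t01.
rewrite /g normrM (le_trans _ (Hv t t01)) //.
apply: ler_piMl => //; move/andP: t01 => [t0 t1].
by rewrite normrX ger0_norm // exprn_ile1.
Qed.

(** A partial derivative of a radial integral is again one, with another exponent and integrand;
    letting both vary makes the family closed under differentiation. *)
Lemma radial_integral_smooth m h :
  smooth_on U h -> smooth_on U (radial_integral m h).
Proof.
pose P (f : 'rV[R]_n -> R) :=
  exists m h, smooth_on U h /\ f = radial_integral m h.
move=> sh; apply: (@smooth_alg_smooth _ _ _ P) => //.
- by move=> _ [k [g [sg ->]]] x Ux; have [] := is_diff_radial_integral k sg Ux.
- move=> _ v [k [g [sg ->]]].
  exists (fun x => \sum_i v 0 i *
    radial_integral (k + w i) (fun y => 'd g y (delta_mx 0 i)) x).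
    apply: alg_sum => i; apply: alg_mul; first exact: alg_cst.
    apply: alg_base; exists (k + w i)%N, (fun y => 'd g y (delta_mx 0 i)).
    by split => //; exact: smooth_on_diff.
  move=> x Ux; have [_ E] := is_diff_radial_integral k sg Ux.
  exact: (congr1 (fun D => D v) E).
- by apply: alg_base; exists m, h.
Qed.

(* [\row_i w_i x_i] is the Euler field of the weights [w], and [t ^ N h (t^w x)]
   is a primitive of its radial derivative. *)
Lemma euler_equation N h : (0 < N)%N -> smooth_on U h ->
  exists2 u : 'rV[R]_n -> R, smooth_on U u & forall x, U x ->
    N%:R * u x + 'd u x (\row_i ((w i)%:R * x 0 i)) = N%:R * h x.
Proof.
move=> N0 sh; pose u0 := radial_integral N.-1 h.
have su0 : smooth_on U u0 by exact: radial_integral_smooth.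
pose u x := N%:R * u0 x.
have duE x v : U x -> 'd u x v = N%:R * 'd u0 x v.
  move=> Ux; have du0 := smooth_on_differentiable su0 Ux.
  have [_ E] := is_diffZ N%:R (differentiableP du0).
  exact: (congr1 (fun D => D v) E).
have su : smooth_on U u.
  apply: (@smooth_alg_smooth _ _ _ (fun=> False)) => //.
  by apply: alg_mul; [exact: alg_cst|exact: alg_smooth].
exists u => // x Ux; rewrite duE // -mulrDr; congr (_ * _).
have [_ E] := is_diff_radial_integral N.-1 sh Ux.
have {}E := congr1 (fun D => D (\row_i ((w i)%:R * x 0 i))) E.
rewrite -[radial_integral N.-1 h]/u0 in E; rewrite E.
pose f (t : R) := t ^+ N * h (wscale w t x).
(* [g] is the derivative of [f]. Integrated, its two summands give N times [u0] and the Euler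
   derivative of [u0], while f 1 - f 0 = h x because N > 0. *)
pose g (t : R) := N%:R * (t ^+ N.-1 * h (wscale w t x)) + \sum_i
  ((w i)%:R * x 0 i) * (t ^+ (N.-1 + w i) * 'd h (wscale w t x) (delta_mx 0 i)).
have cC i : unit_continuous
    (fun t => t ^+ (N.-1 + w i) * 'd h (wscale w t x) (delta_mx 0 i)).
  have sd : smooth_on U (fun y => 'd h y (delta_mx 0 i)) by exact: smooth_on_diff.
  have := unit_continuous_wscale (w := w) (m := (N.-1 + w i)%N) sd Ux. exact.
have cC' i : unit_continuous (fun t => ((w i)%:R * x 0 i) *
    (t ^+ (N.-1 + w i) * 'd h (wscale w t x) (delta_mx 0 i))).
  by apply: unit_continuousM => //; exact: unit_continuous_cst.
have cB := unit_continuous_wscale (w := w) (m := N.-1) sh Ux.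
have cB' : unit_continuous (fun t => N%:R * (t ^+ N.-1 * h (wscale w t x))).
  by apply: unit_continuousM => //; exact: unit_continuous_cst.
have cg : unit_continuous g.
  by apply: unit_continuousD => //; exact: unit_continuous_sum.
have dfg (t : R) : 0 <= t <= 1 -> is_derive t 1 f (g t).
  move=> t01.
  have dh : differentiable h (wscale w t x).
    by apply: smooth_on_differentiable sh _; exact: wscale_ball.
  have [dk kE] := is_diff_comp (is_diff_wscale w t x) (differentiableP dh).
  have h1 : is_derive t (1 : R) (fun s : R => s ^+ N) (N%:R * t ^+ N.-1).
    split; first exact: exprn_derivable.
    by rewrite exp_derive /GRing.scale /= mulr1.
  have h2 : is_derive t (1 : R) (fun s : R => h (wscale w s x))
     (\sum_i ((w i)%:R * t ^+ (w i).-1 * x 0 i) *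
        'd h (wscale w t x) (delta_mx 0 i)).
    split; first exact/derivable1_diffP.
    rewrite deriveE // kE /= scale1r [LHS]diff_sum_coord.
    by apply: eq_bigr => i _; rewrite mxE.
  apply: (is_derive_eq (is_deriveM h1 h2)).
  rewrite /g addrC /GRing.scale /=; congr (_ + _); first by ring.
  rewrite mulr_sumr; apply: eq_bigr => i _.
  (* For weight 0 both terms vanish; otherwise t^(w_i - 1) * t^N = t^(N - 1 + w_i), so the truncated
     predecessor does no harm. *)
  case: (w i) => [|k]; first by rewrite !mul0r mulr0.
  have -> : t ^+ N = t * t ^+ N.-1 by rewrite -exprS prednK.
  by rewrite addnS exprS exprD /=; ring.
have := unit_integral_FTC cg dfg.
rewrite /f expr1n mul1r expr0n gtn_eqF // mul0r subr0.
have -> : wscale w 1 x = x.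
  by apply/rowP => i; rewrite mxE expr1n mul1r.
move=> <-; rewrite /g unit_integralD //; last exact: unit_continuous_sum.
rewrite unit_integralZ // unit_integral_sum //; congr (_ + _).
by apply: eq_bigr => i _; rewrite unit_integralZ // mxE.
Qed.

End radial_integral_smooth.

(** * Prescribing the Jacobian determinant *)

Lemma smooth_on_comp (R : realType) (V : normedModType R) m p q (U : set V)
    (U' : set 'rV[R]_m) (F : 'rV[R]_m -> 'M[R]_(p, q)) (G : V -> 'rV[R]_m) :
  open U -> open U' -> smooth_on U' F -> smooth_on U G ->
  (forall x, U x -> U' (G x)) -> smooth_on U (F \o G).
Proof.
move=> oU oU' sF sG UU'; apply: smooth_on_mx => // i j.
apply: (@smooth_alg_smooth _ _ _ (fun=> False)) => //.
apply: (alg_comp (f := fun y => F y i j) (g := G) oU') => //.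
  exact: smooth_on_coord.
by move=> k; apply: alg_smooth; exact: smooth_on_coord.
Qed.

Lemma smooth_germ_comp (R : realType) (V : normedModType R) m p q
    (F : 'rV[R]_m -> 'M[R]_(p, q)) (G : V -> 'rV[R]_m) :
  smooth_germ F -> smooth_germ G -> G 0 = 0 -> smooth_germ (F \o G).
Proof.
move=> [U' [[oU' U'0] sF]] [U [[oU U0] sG]] G0.
exists (interior (U `&` G @^-1` U')); split.
  split; first exact: open_interior.
  apply: filterI; first exact: open_nbhs_nbhs.
  have cG : {for 0, continuous G}.
    by apply: differentiable_continuous; exact: smooth_on_differentiable sG U0.
  by apply: cG; rewrite G0; exact: open_nbhs_nbhs.
apply: (smooth_on_comp (U' := U')) => //; first exact: open_interior.
  by apply: smooth_on_sub sG => x /interior_subset[].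
by move=> x /interior_subset[].
Qed.

Lemma smooth_germ_differentiable (R : realType) (V W : normedModType R)
    (F : V -> W) : smooth_germ F -> \forall x \near (0 : V), differentiable F x.
Proof.
move=> [U [[oU U0] sF]]; apply: (open_near oU U0) => x Ux.
exact: smooth_on_differentiable sF Ux.
Qed.

Lemma smooth_germ_continuous0 (R : realType) (V W : normedModType R)
    (F : V -> W) : smooth_germ F -> F 0 = 0 -> F @ (0 : V) --> (0 : W).
Proof.
move=> /smooth_germ_differentiable /nbhs_singleton /differentiable_continuous.
by rewrite /prop_for /continuous_at => + F0; rewrite F0.
Qed.

Lemma diffeo_germ_comp (R : realType) r (F G : 'rV[R]_r -> 'rV[R]_r) :
  diffeo_germ F -> diffeo_germ G -> diffeo_germ (F \o G).
Proof.
move=> [sF [F0 [F' [sF' F'0 F'F FF']]]] [sG [G0 [G' [sG' G'0 G'G GG']]]].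
split; first exact: smooth_germ_comp.
split; first by rewrite /= G0.
exists (G' \o F'); split.
- exact: smooth_germ_comp.
- by rewrite /= F'0.
- have H : \forall x \near (0 : 'rV[R]_r), F' (F (G x)) = G x.
    exact: (smooth_germ_continuous0 sG G0 F'F).
  by apply: filterS (filterI H G'G) => x /= [E1 E2]; rewrite E1 E2.
- have H : \forall x \near (0 : 'rV[R]_r), G (G' (F' x)) = F' x.
    exact: (smooth_germ_continuous0 sF' F'0 GG').
  by apply: filterS (filterI H FF') => x /= [E1 E2]; rewrite E1 E2.
Qed.

(** Vectors are rows acted upon from the right, hence the factors appear in the order of
    application. *)
Lemma jacobian_comp (R : realType) m n p (F : 'rV[R]_n -> 'rV[R]_p)
    (G : 'rV[R]_m -> 'rV[R]_n) x :
  differentiable G x -> differentiable F (G x) ->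
  'J (F \o G) x = 'J G x *m 'J F (G x).
Proof.
move=> dG dF; apply/row_matrixP => i.
rewrite !rowE mulmxA -!diff_jacobian.
have [_ E] := is_diff_comp (differentiableP dG) (differentiableP dF).
exact: (congr1 (fun D => D (delta_mx 0 i)) E).
Qed.

Lemma jacobian_near_id (R : realType) n (F : 'rV[R]_n -> 'rV[R]_n) x :
  (\forall y \near x, F y = y) -> 'J F x = 1%:M.
Proof.
move=> Fid; apply/row_matrixP => i; rewrite !rowE -diff_jacobian mulmx1.
have [_ E] := near_is_diff Fid (ex_diff (is_diff_def := is_diff_id x)).
have [_ E'] := is_diff_id x.
by rewrite E E'.
Qed.

Lemma diffeo_jacobian (R : realType) r (F G : 'rV[R]_r -> 'rV[R]_r) :
  smooth_germ F -> smooth_germ G -> F 0 = 0 ->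
  (\forall x \near (0 : 'rV[R]_r), G (F x) = x) ->
  \forall x \near (0 : 'rV[R]_r), \det ('J F x) * \det ('J G (F x)) = 1.
Proof.
move=> sF sG F0 GF.
have h1 := smooth_germ_differentiable sF.
have h2 : \forall x \near (0 : 'rV[R]_r), differentiable G (F x).
  exact: (smooth_germ_continuous0 sF F0 (smooth_germ_differentiable sG)).
have h3 : \forall x \near (0 : 'rV[R]_r), \forall y \near x, (G \o F) y = y.
  exact: (near_join GF).
apply: filterS (filterI h1 (filterI h2 h3)) => x [d1 [d2 d3]].
by rewrite -det_mulmx -jacobian_comp // jacobian_near_id // det1.
Qed.

Lemma det2E (F : comPzRingType) (M : 'M[F]_2) :
  \det M = M 0 0 * M 1 1 - M 0 1 * M 1 0.
Proof.
rewrite (expand_det_row _ 0) !big_ord_recl big_ord0 /cofactor !det_mx11 !mxE /=.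
rewrite !addn0 expr0 expr1 mul1r addr0 mulN1r mulrN.
congr (_ * M _ _ - M _ _ * M _ _); exact: val_inj.
Qed.

(** The base points may differ because Omega has constant coefficients. *)
Lemma Omega_mulmx (R : realType) (M : 'M[R]_2) x y (u v : 'rV[R]_2) :
  @Omega R y (u *m M) (v *m M) = \det M * @Omega R x u v.
Proof.
rewrite /Omega /wedge /dx det2E !mxE !big_ord_recl !big_ord0 /=.
have -> : lift ord0 ord0 = 1 :> 'I_2 by exact: val_inj.
have -> : ord0 = 0 :> 'I_2 by exact: val_inj.
ring.
Qed.

Lemma alg_exp (R : realType) (V : normedModType R) U P (f : V -> R) n :
  smooth_alg U P f -> smooth_alg U P (fun x => f x ^+ n).
Proof.
move=> sf; elim: n => [|n IH].
  rewrite (_ : (fun _ => _) = fun=> 1); first exact: alg_cst.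
  by apply/funext => x; rewrite expr0.
rewrite (_ : (fun _ => _) = fun x => f x * f x ^+ n); first exact: alg_mul.
by apply/funext => x; rewrite exprS.
Qed.

Lemma smooth_on_id (R : realType) (V : normedModType R) (U : set V) :
  open U -> smooth_on U id.
Proof.
move=> oU.
pose S (f : V -> V) := f = id \/ exists c, f = cst c.
apply: (@smooth_on_coind _ _ _ _ S) => //; last by left.
- move=> _ [->|[c ->]] x Ux; last exact: differentiable_cst.
  by have [] := is_diff_id x.
- move=> _ v [->|[c ->]].
    by exists (cst v); [right; exists v|move=> x _; have [_ ->] := is_diff_id x].
  by exists (cst 0); [right; exists 0|move=> x _; rewrite diff_cst].
Qed.

Lemma is_diff_exp (R : realType) (V : normedModType R) (u : V -> R) n x :
  differentiable u x ->
  is_diff x (fun y => u y ^+ n) (fun v => n%:R * u x ^+ n.-1 * 'd u x v).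
Proof.
move=> du; elim: n => [|n IH].
  have := is_diff_cst (1 : R) x.
  by congr (is_diff _ _ _); apply/funext => v; rewrite ?expr0 ?mul0r.
have := is_diffM (differentiableP du) IH.
congr (is_diff _ _ _); apply/funext => v; first by rewrite /= exprS.
transitivity (u x * (n%:R * u x ^+ n.-1 * 'd u x v) + u x ^+ n * 'd u x v) => //.
case: n {IH} => [|n] /=; first by rewrite !expr0; ring.
by rewrite !exprS -[n.+2%:R]natr1; ring.
Qed.

Section prescribed_jacobian.
Context {R : realType}.
Variables (w : 'I_2 -> nat).
Local Notation N := (w 0%R + w 1%R)%N.

(** The Jacobian is diag(u^(w_i)) plus a rank-one matrix built from the gradient of [u], so its
    determinant is u^N + u^(N-1) * E u, where E is the Euler field. Multiplying by N turns the
    second term into E v, since E(u^N) = N u^(N-1) E u. *)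
Lemma det_jacobian_wscale (u v : 'rV[R]_2 -> R) y : (0 < w 0%R)%N ->
  (0 < w 1%R)%N ->
  (\forall x \near y, u x ^+ N = v x) -> differentiable u y ->
  N%:R * \det ('J (fun x => wscale w (u x) x) y) =
  N%:R * v y + 'd v y (\row_i ((w i)%:R * y 0 i)).
Proof.
move=> w0 w1 uv du.
have dv : is_diff y v (fun e => N%:R * u y ^+ N.-1 * 'd u y e).
  have vu : \forall x \near y, v x = u x ^+ N.
    by apply: filterS uv => x ->.
  have [d1 E1] := is_diff_exp N du.
  by have := near_is_diff vu d1; rewrite E1.
have dP : is_diff y (fun x => wscale w (u x) x) (fun e =>
    \row_i (u y ^+ w i * e 0 i +
      y 0 i * ((w i)%:R * u y ^+ (w i).-1 * 'd u y e))).
  apply: is_diff_row => i.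
  have h1 := is_diff_exp (w i) du.
  have h2 := is_diff_coord 0 i (is_diff_id y).
  have := is_diffM h1 h2.
  congr (is_diff _ _ _); apply/funext => e; first by rewrite mxE.
  by rewrite mxE.
have [_ dvE] := dv; have [_ dPE] := dP.
have JE a b : 'J (fun x => wscale w (u x) x) y a b =
   u y ^+ w b * (a == b)%:R +
      y 0 b * ((w b)%:R * u y ^+ (w b).-1 * 'd u y (delta_mx 0 a)).
  rewrite /jacobian /lin1_mx mxE dPE !mxE eqxx /=.
  by rewrite [b == a]eq_sym.
have vE := nbhs_singleton uv.
have dvE' : 'd v y (\row_i ((w i)%:R * y 0 i)) = \sum_i (w i)%:R * y 0 i *
    (N%:R * u y ^+ N.-1 * 'd u y (delta_mx 0 i)).
  rewrite [LHS]diff_sum_coord; apply: eq_bigr => i _.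
  by rewrite mxE dvE.
rewrite dvE' det2E !JE -vE !big_ord_recl big_ord0 /=.
have -> : lift ord0 ord0 = 1 :> 'I_2 by exact: val_inj.
have -> : ord0 = 0 :> 'I_2 by exact: val_inj.
move: ('d u y (delta_mx 0 0)) ('d u y (delta_mx 0 1)) => s t.
move: (y 0 0) (y 0 1) (u y) => y0 y1 z.
case: (w 0) w0 => // a _; case: (w 1) w1 => // b _ /=.
rewrite mulr1 mulr0 mulr1n mulr0n.
rewrite ?addSn ?addnS /= ?addSn ?addnS !exprS !exprD.
ring.
Qed.

Lemma prescribed_jacobian (r : R) (h : 'rV[R]_2 -> R) : (0 < w 0%R)%N ->
  (0 < w 1%R)%N -> 0 < r -> smooth_on (ball 0 r) h -> 0 < h 0 ->
  exists (u : 'rV[R]_2 -> R) (U : set 'rV[R]_2),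
    [/\ open_nbhs 0 U, smooth_on U u, forall y, U y -> 0 < u y,
        diffeo_germ (fun y => wscale w (u y) y)
      & \forall y \near (0 : 'rV[R]_2),
          \det ('J (fun x => wscale w (u x) x) y) = h y].
Proof.
move=> w0 w1 r0 sh h0.
have N0 : (0 < N)%N by rewrite addn_gt0 w0.
have [v sv vE] := euler_equation w N0 sh.
have b0 : ball (0 : 'rV[R]_2) r 0 by exact: ballxx.
(* The Euler field vanishes at the origin, so the equation there reads v 0 = h 0; positivity makes
   the N-th root smooth nearby. *)
have v0 : 0 < v 0.
  have := vE 0 b0.
  have -> : (\row_i ((w i)%:R * (0 : 'rV[R]_2) 0 i)) = 0.
    by apply/rowP => i; rewrite !mxE mulr0.
  rewrite linear0 addr0 => /mulfI -> //.
  by rewrite pnatr_eq0 -lt0n.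
pose U := interior (ball (0 : 'rV[R]_2) r `&` [set y | 0 < v y]).
have oU : open U by exact: open_interior.
have UU y : U y -> ball 0 r y /\ 0 < v y by move=> /interior_subset.
have U0 : U 0.
  apply: filterI; first exact: nbhsx_ballx.
  have cv : {for 0, continuous v}.
    by apply: differentiable_continuous; exact: smooth_on_differentiable sv b0.
  have := cv [set z | 0 < z]; apply.
  exact: lt_nbhsr.
pose u y := v y `^ N%:R^-1.
have svU : smooth_on U v by apply: smooth_on_sub sv => y /UU[].
have su : smooth_on U u.
  apply: (@smooth_alg_smooth _ _ _ (fun=> False)) => //.
  by apply: alg_pow => [|y /UU[]//]; exact: alg_smooth.
have u0 y : U y -> 0 < u y by move=> /UU[_ vy]; exact: powR_gt0.
have uv y : U y -> u y ^+ N = v y.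
  move=> /UU[_ vy]; rewrite /u -powR_mulrn ?powR_ge0 // -powRrM.
  by rewrite mulVf ?powRr1 ?ltW // pnatr_eq0 -lt0n.
have sP : smooth_on U (fun y => wscale w (u y) y).
  apply: smooth_on_mx => // i j.
  apply: (@smooth_alg_smooth _ _ _ (fun=> False)) => //.
  rewrite (_ : (fun _ => _) = fun y => u y ^+ w j * y 0 j); last first.
    by apply/funext => y; rewrite mxE.
  apply: alg_mul; first by apply: alg_exp; exact: alg_smooth.
  apply: alg_smooth; apply: (smooth_on_coord (F := id)) => //.
  exact: smooth_on_id.
have JE y : U y -> \det ('J (fun x => wscale w (u x) x) y) = h y.
  move=> Uy; have uvy : \forall x \near y, u x ^+ N = v x.
    exact: open_near oU Uy uv.
  have := det_jacobian_wscale w0 w1 uvy (smooth_on_differentiable su Uy).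
  rewrite vE; last by have [] := UU y Uy.
  by move/mulfI; apply; rewrite pnatr_eq0 -lt0n.
have P0 : wscale w (u 0) 0 = 0.
  by apply/rowP => i; rewrite !mxE mulr0.
have uJ : 'J (fun x => wscale w (u x) x) 0 \in unitmx.
  by rewrite unitmxE unitfE JE // gt_eqF.
have [G [V [oV Vp sG G0 [FG GF]]]] := inverse_function_theorem oU U0 sP uJ.
rewrite P0 in Vp G0.
exists u, U; split => //; last exact: open_near oU U0 JE.
split; first by exists U.
split=> //; exists G; split => //; first by exists V.
exact: open_near oV Vp FG.
Qed.

End prescribed_jacobian.

(** The degrees split as a_i + a_j so that a dilation acts on [A] as congruence by diag(s^(a_i)).
    Only s > 0 is required, since s will be a value of a positive germ. *)
Definition quasi_homogeneous (R : realType) n k (w : 'I_n -> nat)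
    (a : 'I_k -> nat) (A : 'rV[R]_n -> 'M[R]_k) :=
  forall s x, 0 < s ->
    forall i j, A (wscale w s x) i j = s ^+ (a i + a j) * A x i j.

Lemma mul_eq1_neq0 (F : fieldType) (x y : F) : x * y = 1 -> x != 0.
Proof.
move=> xy; apply/eqP => x0; have := oner_eq0 F.
by rewrite -xy x0 mul0r eqxx.
Qed.

Lemma mul_eq1_gt0 (R : realFieldType) (x y : R) : x * y = 1 -> 0 < x -> 0 < y.
Proof. by move=> xy x0; rewrite -(pmulr_rgt0 _ x0) xy. Qed.

Lemma diffeo_det_neq0 (R : realType) r (Phi : 'rV[R]_r -> 'rV[R]_r) :
  diffeo_germ Phi -> \det ('J Phi 0) != 0.
Proof.
move=> [sF [F0 [G [sG G0 GF FG]]]].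
exact: mul_eq1_neq0 (nbhs_singleton (diffeo_jacobian sF sG F0 GF)).
Qed.

(** [Phi] is followed by the dilation whose determinant is that of the inverse of [Phi]; positivity
    at 0 is what allows prescribing it. *)
Lemma vol_equiv_of_pos (R : realType) k (w : 'I_2 -> nat) (a : 'I_k -> nat)
    (A B : 'rV[R]_2 -> 'M[R]_k) Phi X :
  (0 < w 0%R)%N -> (0 < w 1%R)%N -> quasi_homogeneous w a A ->
  diffeo_germ Phi -> GL_germ X -> G_related Phi X A B ->
  0 < \det ('J Phi 0) -> vol_equiv A B.
Proof.
move=> w0 w1 qA dPhi [sX uX] AB detPhi.
have [sPhi [Phi0 [Th [sTheta Theta0 TP PT]]]] := dPhi.
have detPT := diffeo_jacobian sPhi sTheta Phi0 TP.
have detT : 0 < \det ('J Th 0).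
  have E := nbhs_singleton detPT; rewrite Phi0 in E.
  exact: mul_eq1_gt0 E detPhi.
have [UT [[oUT UT0] sT]] := sTheta.
have /nbhs_ballP[r /= r0 rP] := open_nbhs_nbhs (conj oUT UT0).
have sh : smooth_on (ball 0 r) (fun y => \det ('J Th y)).
  apply: (@smooth_alg_smooth _ _ _ (fun=> False)) => //; first exact: ball_open.
  apply: alg_det => i j; apply: alg_smooth.
  rewrite (_ : (fun _ => _) = fun y => 'd Th y (delta_mx 0 i) 0 j); last first.
    by apply/funext => y; rewrite /jacobian /lin1_mx mxE.
  apply: smooth_on_sub rP _; apply: smooth_on_coord => //.
  exact: smooth_on_diff.
(* From here on only these properties of the determinant of the inverse matter; the last one cancels
   det D Phi. *)
have [h [sh' h0 detPh]] : exists h : 'rV[R]_2 -> R,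
    [/\ smooth_on (ball 0 r) h, 0 < h 0 &
    \forall x \near (0 : 'rV[R]_2), \det ('J Phi x) * h (Phi x) = 1].
  by exists (fun y => \det ('J Th y)).
have [u [U [[oU U0] su u0]]] := prescribed_jacobian w0 w1 r0 sh' h0.
have [Psi PsiE] : exists P, forall y, P y = wscale w (u y) y by eexists.
have <- : Psi = (fun y => wscale w (u y) y) by exact/funext.
move=> dPsi JPsi.
have [sPsi [Psi0 _]] := dPsi.
have cPhi := smooth_germ_continuous0 sPhi Phi0.
have PU : \forall x \near (0 : 'rV[R]_2), U (Phi x).
  by apply: cPhi; exact: open_nbhs_nbhs.
(* [Y] is D^-1 X, which undoes the congruence A(Psi y) = D A(y) D at y = Phi x. *)
pose Y x : 'M[R]_k := \matrix_(i, j) ((u (Phi x) ^+ a i)^-1 * X x i j).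
exists (Psi \o Phi), Y; split.
- exact: diffeo_germ_comp.
- split.
    have [UX [[oUX UX0] sXU]] := sX; have [UP [[oUP UP0] sPU]] := sPhi.
    pose W := interior (UX `&` (UP `&` Phi @^-1` U)).
    have oW : open W by exact: open_interior.
    have WW x : W x -> [/\ UX x, UP x & U (Phi x)].
      by move=> /interior_subset[? []].
    exists W; split.
      split => //; apply: filterI; first exact: open_nbhs_nbhs.
      by apply: filterI => //; exact: open_nbhs_nbhs.
    apply: smooth_on_mx => // i j.
    apply: (@smooth_alg_smooth _ _ _ (fun=> False)) => //.
    rewrite (_ : (fun _ => _) = fun x => (u (Phi x) ^+ a i)^-1 * X x i j); last first.
      by apply/funext => x; rewrite mxE.
    apply: alg_mul; last first.
      apply: alg_smooth; apply: smooth_on_coord => //.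
      by apply: smooth_on_sub sXU => x /WW[].
    apply: alg_inv; last first.
      by move=> x /WW[_ _ /u0 ?]; rewrite expf_neq0 // gt_eqF.
    apply: alg_exp; apply: (alg_comp (f := u) (g := Phi) oU) => //.
      by move=> x /WW[].
    move=> l; apply: alg_smooth; apply: smooth_on_coord => //.
    by apply: smooth_on_sub sPU => x /WW[].
  apply: filterS (filterI PU uX) => x [/u0 ux uXx].
  have -> : Y x = diag_mx (\row_i (u (Phi x) ^+ a i)^-1) *m X x.
    by apply/matrixP => i j; rewrite mul_diag_mx !mxE.
  rewrite unitmx_mul uXx andbT unitmxE det_diag unitfE.
  by apply/prodf_neq0 => i _; rewrite mxE invr_neq0 // expf_neq0 // gt_eqF.
- apply: filterS (filterI PU AB) => x [/u0 ux ->].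
  pose D : 'M[R]_k := diag_mx (\row_i u (Phi x) ^+ a i).
  pose D' : 'M[R]_k := diag_mx (\row_i (u (Phi x) ^+ a i)^-1).
  have une i : u (Phi x) ^+ a i != 0 by rewrite expf_neq0 // gt_eqF.
  have DD' : D *m D' = 1%:M.
    apply/matrixP => i j; rewrite mul_diag_mx !mxE.
    by case: eqP => [->|_]; rewrite ?mulr1n ?mulr0n ?mulr0 // divff.
  have D'D : D' *m D = 1%:M.
    apply/matrixP => i j; rewrite mul_diag_mx !mxE.
    by case: eqP => [->|_]; rewrite ?mulr1n ?mulr0n ?mulr0 // mulVf.
  have YE : Y x = D' *m X x.
    by apply/matrixP => i j; rewrite mul_diag_mx !mxE.
  have AE : A ((Psi \o Phi) x) = D *m A (Phi x) *m D.
    apply/matrixP => i j; rewrite /= PsiE qA // mul_mx_diag mul_diag_mx !mxE.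
    by rewrite exprD; ring.
  rewrite AE YE trmx_mul tr_diag_mx !mulmxA.
  rewrite -(mulmxA (X x)^T D' D) D'D mulmx1.
  by rewrite -(mulmxA _ D D') DD' mulmx1.
- have h1 := smooth_germ_differentiable sPhi.
  have h2 : \forall x \near (0 : 'rV[R]_2), differentiable Psi (Phi x).
    exact: (cPhi _ (smooth_germ_differentiable sPsi)).
  have h3 : \forall x \near (0 : 'rV[R]_2),
      \det ('J Psi (Phi x)) = h (Phi x).
    exact: (cPhi _ JPsi).
  apply: filterS (filterI (filterI h1 h2) (filterI h3 detPh)).
  move=> x [[d1 d2] [E1 E2]].
  apply/funext => e; apply/funext => f; rewrite /pullback.
  transitivity (@Omega R (Psi (Phi x)) (e *m 'J (Psi \o Phi) x)
      (f *m 'J (Psi \o Phi) x)); first by rewrite -!diff_jacobian.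
  apply: etrans (Omega_mulmx ('J (Psi \o Phi) x) x _ e f) _.
  have JE : \det ('J (Psi \o Phi) x) = 1.
    apply: etrans (congr1 determinant (jacobian_comp d1 d2)) _.
    apply: etrans (det_mulmx _ _) (etrans _ E2).
    exact: congr1 E1.
  exact: etrans (congr1 (fun c => c * _) JE) (mul1r _).
Qed.

(** * The normal forms *)

Lemma smooth_on_mulmxr (R : realType) n m (M : 'M[R]_(n, m)) :
  smooth_on setT (fun v : 'rV[R]_n => v *m M).
Proof.
apply: smooth_on_mx => [|i j]; first exact: openT.
apply: (@smooth_alg_smooth _ _ _ (fun=> False)) => //; first exact: openT.
rewrite (_ : (fun _ => _) = fun v : 'rV[R]_n => \sum_k v i k * M k j); last first.
  by apply/funext => v; rewrite mxE.
apply: alg_sum => k; apply: alg_mul; last exact: alg_cst.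
apply: alg_smooth; apply: (smooth_on_coord (F := id)); first exact: openT.
by apply: smooth_on_id; exact: openT.
Qed.

Lemma smooth_germ_mulmxr (R : realType) n m (M : 'M[R]_(n, m)) :
  smooth_germ (fun v : 'rV[R]_n => v *m M).
Proof.
exists setT; split; last exact: smooth_on_mulmxr.
by split=> //; exact: openT.
Qed.

Lemma jacobian_mulmxr (R : realType) n m (M : 'M[R]_(n, m)) x :
  'J (fun v : 'rV[R]_n => v *m M) x = M.
Proof.
apply/row_matrixP => i; rewrite !rowE -diff_jacobian.
have E := @diff_lin R _ _ (mulmxr M) x (@mulmxr_rV_continuous R n m M).
exact: (congr1 (fun D => D (delta_mx 0 i)) E).
Qed.

Lemma diffeo_mulmxr (R : realType) n (M : 'M[R]_n) :
  M \in unitmx -> diffeo_germ (fun v : 'rV[R]_n => v *m M).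
Proof.
move=> uM; split; first exact: smooth_germ_mulmxr.
split; first exact: mul0mx.
exists (fun v => v *m invmx M); split; first exact: smooth_germ_mulmxr.
- exact: mul0mx.
- by near=> x; rewrite mulmxK.
- by near=> x; rewrite mulmxKV.
Unshelve. all: by end_near. Qed.

Lemma GL_germ_mull (R : realType) r k (P : 'M[R]_k) (X : 'rV[R]_r -> 'M[R]_k) :
  P \in unitmx -> GL_germ X -> GL_germ (fun x => P *m X x).
Proof.
move=> uP [[U [[oU U0] sX]] uX]; split.
  exists U; split => //; apply: smooth_on_mx => // i j.
  apply: (@smooth_alg_smooth _ _ _ (fun=> False)) => //.
  rewrite (_ : (fun _ => _) = fun v => \sum_k P i k * X v k j); last first.
    by apply/funext => v; rewrite mxE.
  apply: alg_sum => l; apply: alg_mul; first exact: alg_cst.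
  by apply: alg_smooth; exact: smooth_on_coord.
by apply: filterS uX => x uXx; rewrite unitmx_mul uP.
Qed.

(* The Jacobian determinant of an equivalence is either positive, or made
   positive by the orientation-reversing linear map [S]. *)
Lemma vol_equiv_or (R : realType) k (w : 'I_2 -> nat) (a : 'I_k -> nat)
    (A A' B : 'rV[R]_2 -> 'M[R]_k) (S : 'M[R]_2) (P : 'M[R]_k) :
  (0 < w 0%R)%N -> (0 < w 1%R)%N ->
  quasi_homogeneous w a A -> quasi_homogeneous w a A' ->
  \det S < 0 -> P \in unitmx ->
  (forall x, A x = P^T *m A' (x *m S) *m P) ->
  G_equiv A B -> vol_equiv A B \/ vol_equiv A' B.
Proof.
move=> w0 w1 qA qA' S0 uP AA' [Phi [X [dPhi gX AB]]].
have := diffeo_det_neq0 dPhi; rewrite neq_lt => /orP[neg|pos]; last first.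
  by left; exact: (vol_equiv_of_pos w0 w1 qA dPhi gX AB pos).
have uS : S \in unitmx by rewrite unitmxE unitfE lt_eqF.
have dS := diffeo_mulmxr uS.
have dSP := diffeo_germ_comp dS dPhi.
right; apply: (vol_equiv_of_pos w0 w1 qA' dSP (GL_germ_mull uP gX)).
- apply: filterS AB => x ->.
  by rewrite AA' trmx_mul !mulmxA.
- have [sS [_ _]] := dS; have [sPhi [Phi0 _]] := dPhi.
  have d1 := nbhs_singleton (smooth_germ_differentiable sPhi).
  have d2 : differentiable (fun v : 'rV[R]_2 => v *m S) (Phi 0).
    by apply: (smooth_on_differentiable (smooth_on_mulmxr S)).
  have E : \det ('J ((fun v => v *m S) \o Phi) 0) = \det ('J Phi 0) * \det S.
    apply: etrans (congr1 determinant (jacobian_comp d1 d2)) _.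
    apply: etrans (det_mulmx _ _) _.
    by congr (_ * _); congr determinant; exact: jacobian_mulmxr.
  by rewrite E nmulr_rgt0.
Qed.

Definition mx2 (R : realType) (a b c d : R) : 'M[R]_2 :=
  \matrix_(i, j) (nth [::] [:: [:: a; b]; [:: c; d]] i)`_j.

Lemma mulmx2E (R : realType) (x : 'rV[R]_2) (a b c d : R) :
  ((x *m mx2 a b c d) 0 0 = x 0 0 * a + x 0 1 * c) *
  ((x *m mx2 a b c d) 0 1 = x 0 0 * b + x 0 1 * d).
Proof.
rewrite !mxE !big_ord_recl !big_ord0 !mxE /= !addr0.
have -> : lift ord0 ord0 = 1 :> 'I_2 by exact: val_inj.
by have -> : ord0 = 0 :> 'I_2 by exact: val_inj.
Qed.

Lemma det_mx2 (R : realType) (a b c d : R) :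
  \det (mx2 a b c d) = a * d - b * c.
Proof. by rewrite det2E !mxE. Qed.

Definition nats n (s : seq nat) (i : 'I_n) : nat := nth 0%N s i.
Arguments nats {n} s%_N i.

Lemma wscale2E (R : realType) (s : R) (x : 'rV[R]_2) a b :
  (wscale (nats [:: a; b]) s x 0 0 = s ^+ a * x 0 0) *
  (wscale (nats [:: a; b]) s x 0 1 = s ^+ b * x 0 1).
Proof. by rewrite !mxE. Qed.

Ltac by_entries := let i := fresh in let j := fresh in
  move=> [[|[|[|//]]] i] [[|[|[|//]]] j].

(** * Weights of the ten families *)

Section quasi_homogeneous_germs.
Variable R : realType.

(** A diagonal entry of degree d forces the row weight d / 2, so weights are scaled until row
    weights are integers. For germs 6 to 10 the ratio of the variable weights, 4:3, 3:2 or 5:3, is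
    that of the singularity E6, E7 or E8 defined by the determinant. *)
Lemma germ1_qh : quasi_homogeneous (nats [:: 2; 2]) (nats [:: 1; 1; 1]) (@germ1 R).
Proof.
move=> s x s0; by_entries; rewrite /germ1 !wscale2E !mxE /nats /=; ring.
Qed.

Lemma germ2_qh b :
  quasi_homogeneous (nats [:: 2; 2]) (nats [:: 1; 1; 1]) (@germ2 R b).
Proof.
move=> s x s0; by_entries; rewrite /germ2 !wscale2E !mxE /nats /=; ring.
Qed.

Lemma germ3_qh b :
  quasi_homogeneous (nats [:: 2; 2]) (nats [:: 1; 1; 1]) (@germ3 R b).
Proof.
move=> s x s0; by_entries; rewrite /germ3 !wscale2E !mxE /nats /=; ring.
Qed.

(** Twice the natural weights ((l1 + l2) / 2, 1): the square of x1 must have the degree of the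
    product of the first two diagonal entries. *)
Lemma germ4_qh b1 b2 l1 l2 :
  quasi_homogeneous (nats [:: l1 + l2; 2]) (nats [:: l1; l2; 1])
    (@germ4 R b1 b2 l1 l2).
Proof.
move=> s x s0; by_entries;
  rewrite /germ4 !wscale2E !mxE /nats /= ?exprMn ?exprD -?exprM ?mul2n -?addnn ?exprD; ring.
Qed.

Lemma germ5_qh l :
  quasi_homogeneous (nats [:: l.*2; 2]) (nats [:: l; l; 1]) (@germ5 R l).
Proof.
move=> s x s0; by_entries;
  rewrite /germ5 !wscale2E !mxE /nats /= ?exprMn -?exprM ?mul2n -?addnn ?exprD; ring.
Qed.

Lemma germ6_qh b :
  quasi_homogeneous (nats [:: 4; 3]) (nats [:: 1; 2; 3]) (@germ6 R b).
Proof.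
move=> s x s0; by_entries; rewrite /germ6 !wscale2E !mxE /nats /=; ring.
Qed.

Lemma germ7_qh :
  quasi_homogeneous (nats [:: 6; 4]) (nats [:: 1; 3; 5]) (@germ7 R).
Proof.
move=> s x s0; by_entries; rewrite /germ7 !wscale2E !mxE /nats /=; ring.
Qed.

Lemma germ8_qh b :
  quasi_homogeneous (nats [:: 6; 4]) (nats [:: 2; 4; 3]) (@germ8 R b).
Proof.
move=> s x s0; by_entries; rewrite /germ8 !wscale2E !mxE /nats /=; ring.
Qed.

Lemma germ9_qh :
  quasi_homogeneous (nats [:: 10; 6]) (nats [:: 1; 5; 9]) (@germ9 R).
Proof.
move=> s x s0; by_entries; rewrite /germ9 !wscale2E !mxE /nats /=; ring.
Qed.

Lemma germ10_qh :
  quasi_homogeneous (nats [:: 10; 6]) (nats [:: 3; 7; 5]) (@germ10 R).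
Proof.
move=> s x s0; by_entries; rewrite /germ10 !wscale2E !mxE /nats /=; ring.
Qed.

End quasi_homogeneous_germs.
Lemma reflect1_row (R : realType) (x : 'rV[R]_2) :
  (\row_(j < 2) (if j == 0 then - x 0 j else x 0 j)) = x *m mx2 (-1) 0 0 1.
Proof.
apply/rowP => j; rewrite mxE; have [->|j0] := eqVneq j 0.
  by rewrite mulmx2E; ring.
have -> : j = 1 by case: j j0 => [[|[|//]] ?] // _; exact: val_inj.
by rewrite mulmx2E; ring.
Qed.

Lemma reflect1E (R : realType) n (A : 'rV[R]_2 -> 'M[R]_n) x :
  reflect1 A x = A (x *m mx2 (-1) 0 0 1).
Proof. by rewrite /reflect1 reflect1_row. Qed.

Lemma mulmx_reflectK (R : realType) (x : 'rV[R]_2) :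
  x *m mx2 (-1) 0 0 1 *m mx2 (-1) 0 0 1 = x.
Proof.
apply/rowP => j; case: j => [[|[|//]] j2].
- have -> : Ordinal j2 = 0 by exact: val_inj.
  by rewrite !mulmx2E; ring.
- have -> : Ordinal j2 = 1 by exact: val_inj.
  by rewrite !mulmx2E; ring.
Qed.

Lemma reflect1_qh (R : realType) k (w : 'I_2 -> nat) (a : 'I_k -> nat)
    (A : 'rV[R]_2 -> 'M[R]_k) :
  quasi_homogeneous w a A -> quasi_homogeneous w a (reflect1 A).
Proof.
move=> qA s x s0 i j; rewrite /reflect1 -qA //; congr (A _ _ _).
by apply/rowP => l; rewrite !mxE; case: ifP => _ //; rewrite mulrN.
Qed.

Lemma det_reflect (R : realType) : \det (mx2 (-1 : R) 0 0 1) < 0.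
Proof. by rewrite det_mx2 mul0r subr0 mulr1 ltrN10. Qed.

(** Each germ has a linear involution of determinant -1 undone by a signed permutation that is its
    own inverse. Germ 1 exchanges x2 with x1 - x2, germ 2 exchanges x1 with x2, and germs 3, 4 and 6
    change the sign of one variable and of one basis vector. *)
Lemma unsplit_vol_equiv (R : realType) (A B : 'rV[R]_2 -> 'M[R]_3) :
  unsplit_germ A -> G_equiv A B -> vol_equiv A B.
Proof.
(* With A' = A the two alternatives of [vol_equiv_or] coincide. *)
have id_or (Q : Prop) : Q \/ Q -> Q by case.
have unit3 (P : 'M[R]_3) : P *m P = 1%:M -> P \in unitmx.
  by move=> /mulmx1_unit[].
move=> uA AB; apply: id_or; case: uA AB => [|s|s|s1 s2 l1 l2 l21 l20 l12|s].
- apply: (@vol_equiv_or R 3 _ _ _ _ _ (mx2 1 1 0 (-1))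
    (mx3 [:: [:: 1; 0; 0]; [:: 0; 0; 1]; [:: 0; 1; 0]])
    _ _ (@germ1_qh R) (@germ1_qh R)) => //.
  + by rewrite det_mx2; lra.
  + apply: unit3; apply/matrixP; by_entries;
      rewrite !(mxE, big_ord_recl, big_ord0) /=; ring.
  + move=> x; apply/matrixP; by_entries;
      rewrite /germ1 !mulmx2E !(mxE, big_ord_recl, big_ord0) /=; ring.
- apply: (@vol_equiv_or R 3 _ _ _ _ _ (mx2 0 1 1 0)
    (mx3 [:: [:: 0; 1; 0]; [:: 1; 0; 0]; [:: 0; 0; 1]])
    _ _ (@germ2_qh R s) (@germ2_qh R s)) => //.
  + by rewrite det_mx2; lra.
  + apply: unit3; apply/matrixP; by_entries;
      rewrite !(mxE, big_ord_recl, big_ord0) /=; ring.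
  + move=> x; apply/matrixP; by_entries;
      rewrite /germ2 !mulmx2E !(mxE, big_ord_recl, big_ord0) /=; ring.
- apply: (@vol_equiv_or R 3 _ _ _ _ _ (mx2 1 0 0 (-1))
    (mx3 [:: [:: 1; 0; 0]; [:: 0; 1; 0]; [:: 0; 0; -1]])
    _ _ (@germ3_qh R s) (@germ3_qh R s)) => //.
  + by rewrite det_mx2; lra.
  + apply: unit3; apply/matrixP; by_entries;
      rewrite !(mxE, big_ord_recl, big_ord0) /=; ring.
  + move=> x; apply/matrixP; by_entries;
      rewrite /germ3 !mulmx2E !(mxE, big_ord_recl, big_ord0) /=; ring.
- apply: (@vol_equiv_or R 3 _ _ _ _ _ (mx2 (-1) 0 0 1)
    (mx3 [:: [:: 1; 0; 0]; [:: 0; -1; 0]; [:: 0; 0; 1]])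
    _ _ (@germ4_qh R s1 s2 l1 l2) (@germ4_qh R s1 s2 l1 l2)) => //.
  + by rewrite /nats /= addn_gt0 (leq_trans l20 l21).
  + exact: det_reflect.
  + apply: unit3; apply/matrixP; by_entries;
      rewrite !(mxE, big_ord_recl, big_ord0) /=; ring.
  + move=> x; rewrite /germ4 !mulmx2E.
    (* The base of the powers with symbolic exponents is simplified before [ring] is called. *)
    have -> : x 0 0 * 0 + x 0 1 * 1 = x 0 1 by ring.
    apply/matrixP; by_entries;
      rewrite !(mxE, big_ord_recl, big_ord0) /=; ring.
- apply: (@vol_equiv_or R 3 _ _ _ _ _ (mx2 1 0 0 (-1))
    (mx3 [:: [:: 1; 0; 0]; [:: 0; -1; 0]; [:: 0; 0; 1]])
    _ _ (@germ6_qh R s) (@germ6_qh R s)) => //.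
  + by rewrite det_mx2; lra.
  + apply: unit3; apply/matrixP; by_entries;
      rewrite !(mxE, big_ord_recl, big_ord0) /=; ring.
  + move=> x; apply/matrixP; by_entries;
      rewrite /germ6 !mulmx2E !(mxE, big_ord_recl, big_ord0) /=; ring.
Qed.

Lemma G_equiv_reflect1 (R : realType) (A : 'rV[R]_2 -> 'M[R]_3) :
  G_equiv A (reflect1 A).
Proof.
exists (fun x => x *m mx2 (-1) 0 0 1), (fun=> 1%:M); split.
- by apply: diffeo_mulmxr; rewrite unitmxE unitfE lt_eqF // det_reflect.
- split; last by near=> x; exact: unitmx1.
  exists setT; split; first by split => //; exact: openT.
  apply: smooth_on_mx => [|i j]; first exact: openT.
  apply: (@smooth_alg_smooth _ _ _ (fun=> False)) => //; first exact: openT.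
  exact: alg_cst.
- by near=> x; rewrite reflect1E trmx1 mul1mx mulmx1.
Unshelve. all: by end_near. Qed.

Lemma vol_equiv_or_reflect1 (R : realType) (A B : 'rV[R]_2 -> 'M[R]_3)
    (w : 'I_2 -> nat) (a : 'I_3 -> nat) :
  (0 < w 0%R)%N -> (0 < w 1%R)%N -> quasi_homogeneous w a A ->
  G_equiv A B -> vol_equiv A B \/ vol_equiv (reflect1 A) B.
Proof.
move=> w0 w1 qA; apply: (@vol_equiv_or R 3 w a A (reflect1 A) B
  (mx2 (-1) 0 0 1) 1%:M) => //.
- exact: reflect1_qh.
- exact: det_reflect.
- exact: unitmx1.
- by move=> x; rewrite reflect1E mulmx_reflectK trmx1 mul1mx mulmx1.
Qed.

Lemma split_vol_equiv (R : realType) (A B : 'rV[R]_2 -> 'M[R]_3) :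
  split_germ A -> G_equiv A B -> vol_equiv A B \/ vol_equiv (reflect1 A) B.
Proof.
case=> [l l2||s||].
- apply: vol_equiv_or_reflect1 (@germ5_qh R l) => //.
  by rewrite /nats /= double_gt0 (leq_trans _ l2).
- exact: vol_equiv_or_reflect1 (@germ7_qh R).
- exact: vol_equiv_or_reflect1 (@germ8_qh R s).
- exact: vol_equiv_or_reflect1 (@germ9_qh R).
- exact: vol_equiv_or_reflect1 (@germ10_qh R).
Qed.

(** * Orientation-reversing equivalences *)

(** The partial derivatives, being differentiable, are Lipschitz at 0; the mean value theorem turns
    this into a quadratic remainder. A remainder o(|x|) would not do along curves whose coordinates
    have different orders. *)
Lemma taylor2 (R : realType) n m (F : 'rV[R]_n -> 'rV[R]_m) :
  smooth_germ F -> exists C, \forall x \near (0 : 'rV[R]_n),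
    `|F x - F 0 - x *m 'J F 0| <= C * `|x| ^+ 2.
Proof.
move=> [U [[oU U0] sF]].
have /nbhs_ballP[r /= r0 rP] := open_nbhs_nbhs (conj oU U0).
pose G i j (y : 'rV[R]_n) := 'd F y (delta_mx 0 i) 0 j.
have sG i j : smooth_on U (G i j).
  by apply: smooth_on_coord => //; exact: smooth_on_diff.
have H i j : exists C, \forall y \near (0 : 'rV[R]_n),
    `|G i j y - G i j 0| <= C * `|y|.
  have dG := smooth_on_differentiable (sG i j) U0.
  have [k k0 kP] := linear_lipschitz (diff_continuous dG).
  exists (1 + k); near=> y.
  have h1 : `|G i j (0 + y) - G i j 0 - 'd (G i j) 0 y| <= 1 * `|y|.
    by near: y; exact: diff_eps dG _ ltr01.
  rewrite add0r in h1; rewrite mulrDl.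
  have h2 := lerD h1 (kP y); apply: le_trans h2.
  by rewrite -{1}[G i j y - G i j 0](subrK ('d (G i j) 0 y)) ler_normD.
pose C i j := sval (cid (H i j)).
have HC : \forall y \near (0 : 'rV[R]_n), forall i j,
    `|G i j y - G i j 0| <= C i j * `|y|.
  have FF : Filter (nbhs (0 : 'rV[R]_n)) by exact: nbhs_filter.
  apply: (@filter_forall _ _ _ _ FF) => i.
  apply: (@filter_forall _ _ _ _ FF) => j.
  exact: (svalP (cid (H i j))).
have /nbhs_ballP[d /= d0 dP] := HC.
pose K := \sum_j \sum_i `|C i j|.
exists K; apply/nbhs_ballP; exists (Num.min r d) => /=; first by rewrite lt_min r0.
move=> x; rewrite -ball_normE /= sub0r normrN lt_min => /andP[xr xd].
have tx (t : R) : 0 <= t <= 1 -> `|t *: x| <= `|x|.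
  by move=> /andP[t0 t1]; rewrite normrZ ger0_norm // ler_piMl.
apply: mx_norm_le => [|a j].
  by rewrite mulr_ge0 // ?exprn_ge0 // sumr_ge0 // => j _; exact: sumr_ge0.
rewrite ord1 {a}.
have dFj t : 0 <= t <= 1 -> differentiable (fun y => F y 0 j) (0 + t *: (x - 0)).
  move=> t01; rewrite add0r subr0.
  apply: smooth_on_differentiable (smooth_on_coord 0 j oU sF) _; apply: rP.
  by rewrite -ball_normE /= sub0r normrN (le_lt_trans (tx t t01)).
have [t t01 tE] := segment_MVT dFj.
rewrite subr0 add0r in tE.
have dF y : U y -> forall v, 'd (fun y => F y 0 j) y v = \sum_i v 0 i * G i j y.
  move=> Uy v; rewrite [LHS]is_diff_coord_diff; last first.
    exact: smooth_on_differentiable sF Uy.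
  by rewrite diff_sum_coord summxE; apply: eq_bigr => i _; rewrite mxE.
have Utx : U (t *: x).
  by apply: rP; rewrite -ball_normE /= sub0r normrN (le_lt_trans (tx t t01)).
have -> : (F x - F 0 - x *m 'J F 0) 0 j = \sum_i x 0 i * (G i j (t *: x) - G i j 0).
  transitivity (\sum_i x 0 i * G i j (t *: x) - \sum_i x 0 i * G i j 0).
    transitivity ((F x 0 j - F 0 0 j) - (x *m 'J F 0) 0 j); first by rewrite !mxE.
    congr (_ - _); first exact: etrans tE (dF _ Utx x).
    rewrite mxE; apply: eq_bigr => i _.
    by congr (_ * _); rewrite /jacobian /lin1_mx mxE.
  by rewrite -sumrB; apply: eq_bigr => i _; rewrite mulrBr.
rewrite (le_trans (ler_norm_sum _ _ _)) //.
have Hb : forall i j, `|G i j (t *: x) - G i j 0| <= C i j * `|t *: x|.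
  by apply: dP; rewrite -ball_normE /= sub0r normrN (le_lt_trans (tx t t01)).
have le1 i : `|x 0 i * (G i j (t *: x) - G i j 0)| <= `|C i j| * `|x| ^+ 2.
  rewrite normrM expr2 mulrCA; apply: ler_pM => //; first exact: mx_norm_ge.
  apply: le_trans (Hb i j) _.
  apply: (@le_trans _ _ (`|C i j| * `|t *: x|)).
    by apply: ler_wpM2r => //; exact: ler_norm.
  by apply: ler_wpM2l => //; exact: tx.
apply: le_trans (ler_sum _ (fun i _ => le1 i)) _.
rewrite -mulr_suml ler_wpM2r ?exprn_ge0 // /K (bigD1 j) //= lerDl.
by apply: sumr_ge0 => l _; exact: sumr_ge0.
Unshelve. all: by end_near. Qed.

Lemma cvg_at_right0_ge0 (R : realType) (g : R -> R) (l : R) :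
  g t @[t --> (0 : R)^'+] --> l -> (\forall t \near (0 : R)^'+, 0 <= g t) -> 0 <= l.
Proof.
move=> gl g0.
exact: (@closed_cvg R R _ _ g [set z : R | 0 <= z] (@closed_ge R 0) g0 l gl).
Qed.

Lemma expr_at_right0 (R : realType) k : (0 < k)%N ->
  (t : R) ^+ k @[t --> (0 : R)^'+] --> (0 : R).
Proof.
move=> k0; have := @exprn_continuous R k 0; rewrite /continuous_at expr0n gtn_eqF //.
by move=> c; apply: cvg_at_right_filter.
Qed.

Lemma squeeze_at_right0 (R : realType) (g h : R -> R) (K l : R) k : (0 < k)%N ->
  (\forall t \near (0 : R)^'+, `|g t - h t| <= K * t ^+ k) ->
  h t @[t --> (0 : R)^'+] --> l -> g t @[t --> (0 : R)^'+] --> l.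
Proof.
move=> k0 H hl.
have c0 : (g t - h t) @[t --> (0 : R)^'+] --> (0 : R).
  apply/norm_cvg0P.
  apply: (@squeeze_cvgr _ _ _ _ (fun=> 0) (fun t => K * t ^+ k)).
  - by apply: filterS H => t ->; rewrite normr_ge0.
  - exact: cvg_cst.
  - rewrite -[X in _ --> X](mulr0 K); apply: cvgM; first exact: cvg_cst.
    exact: expr_at_right0.
rewrite (_ : g = fun t => (g t - h t) + h t); last first.
  by apply/funext => t; rewrite subrK.
by rewrite -[l]add0r; exact: cvgD.
Qed.

(** * Images of weighted curves under a germ *)

Definition row2 (R : realType) (a b : R) : 'rV[R]_2 :=
  \row_j (if j == 0 then a else b).

Lemma row2E (R : realType) (a b : R) :
  (row2 a b 0 0 = a) * (row2 a b 0 1 = b).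
Proof. by rewrite !mxE. Qed.

Lemma row2_mulmx (R : realType) (a b : R) (L : 'M[R]_2) j :
  (row2 a b *m L) 0 j = a * L 0 j + b * L 1 j.
Proof.
rewrite mxE !big_ord_recl big_ord0 addr0.
have -> : lift ord0 ord0 = 1 :> 'I_2 by exact: val_inj.
have -> : ord0 = 0 :> 'I_2 by exact: val_inj.
by rewrite !row2E.
Qed.

Lemma row2_norm (R : realType) (a b m : R) :
  `|a| <= m -> `|b| <= m -> `|row2 a b| <= m.
Proof.
move=> am bm; apply: mx_norm_le => [|i j]; first exact: le_trans (normr_ge0 a) am.
by rewrite mxE; case: ifP.
Qed.

Section curves.
Context {R : realType}.
Variables (al be : R) (p q : nat).

Let m := `|al| + `|be|.

Lemma curve_norm (t : R) : (q <= p)%N -> 0 <= t <= 1 ->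
  `|row2 (al * t ^+ p) (be * t ^+ q)| <= m * t ^+ q.
Proof.
move=> qp /andP[t0 t1].
have tp : t ^+ p <= t ^+ q by apply: ler_wiXn2l.
have tq : 0 <= t ^+ q by exact: exprn_ge0.
apply: row2_norm; rewrite normrM (ger0_norm (exprn_ge0 _ t0)) /m mulrDl.
  by rewrite -[leLHS]addr0 lerD ?mulr_ge0 // ler_wpM2l.
by rewrite -[leLHS]add0r lerD ?mulr_ge0.
Qed.

Lemma curve_at_right0 : (0 < q)%N -> (q <= p)%N ->
  row2 (al * t ^+ p) (be * t ^+ q) @[t --> (0 : R)^'+] --> (0 : 'rV[R]_2).
Proof.
move=> q0 qp; apply/norm_cvg0P.
apply: (@squeeze_cvgr _ _ _ _ (fun=> 0) (fun t => m * t ^+ q)).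
- near=> t; rewrite normr_ge0 /= curve_norm //; apply/andP; split.
    by near: t; exact: nbhs_right_ge.
  by near: t; apply: nbhs_right_le.
- exact: cvg_cst.
- rewrite -[X in _ --> X](mulr0 m); apply: cvgM; first exact: cvg_cst.
  exact: expr_at_right0.
Unshelve. all: by end_near. Qed.

(** In the first coordinate the term be * t^q of the linear part would dominate t^p when q < p,
    hence the condition on the lower left entry. The factor 0 ^+ (p - q) is 1 if p = q and 0
    otherwise, so both cases share one formula. The Taylor remainder has order t^(2q), negligible
    because p < 2q. *)
Lemma curve_cvg (F : 'rV[R]_2 -> 'rV[R]_2) : smooth_germ F -> F 0 = 0 ->
  (0 < q)%N -> (q <= p)%N -> (p < q.*2)%N -> (p == q) || ('J F 0 1 0 == 0) ->
  (F (row2 (al * t ^+ p) (be * t ^+ q)) 0 0 / t ^+ p @[t --> (0 : R)^'+]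
     --> al * 'J F 0 0 0 + be * 'J F 0 1 0) /\
  (F (row2 (al * t ^+ p) (be * t ^+ q)) 0 1 / t ^+ q @[t --> (0 : R)^'+]
     --> al * 'J F 0 0 1 * 0 ^+ (p - q) + be * 'J F 0 1 1).
Proof.
move=> sF F0 q0 qp pq2 pqL.
have [C HC] := taylor2 sF.
move: ('J F 0) HC pqL => L HC pqL.
pose c (t : R) := row2 (al * t ^+ p) (be * t ^+ q).
have H : \forall t \near (0 : R)^'+, forall j,
    `|F (c t) 0 j - (c t *m L) 0 j| <= `|C| * m ^+ 2 * (t ^+ (q.*2)).
  have H1 : \forall t \near (0 : R)^'+, `|F (c t) - F 0 - c t *m L| <= C * `|c t| ^+ 2.
    exact: (curve_at_right0 q0 qp HC).
  near=> t => j.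
  have t01 : 0 <= t <= 1.
    apply/andP; split; first by near: t; exact: nbhs_right_ge.
    by near: t; apply: nbhs_right_le.
  have h1 : `|F (c t) - F 0 - c t *m L| <= C * `|c t| ^+ 2 by near: t; exact: H1.
  have -> : F (c t) 0 j - (c t *m L) 0 j = (F (c t) - F 0 - c t *m L) 0 j.
    by rewrite F0 subr0 !mxE.
  apply: le_trans (mx_norm_ge _ _ _) _; apply: le_trans h1 _.
  have -> : t ^+ q.*2 = (t ^+ q) ^+ 2 by rewrite -exprM muln2.
  rewrite -mulrA -exprMn.
  have cm := curve_norm qp t01.
  apply: (@le_trans _ _ (`|C| * `|c t| ^+ 2)).
    by apply: ler_wpM2r; [exact: exprn_ge0|exact: ler_norm].
  apply: ler_wpM2l => //; rewrite lerXn2r ?nnegrE //.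
  exact: le_trans cm.
have bound j k : (k < q.*2)%N -> \forall t \near (0 : R)^'+,
    `|F (c t) 0 j / t ^+ k - (c t *m L) 0 j / t ^+ k|
      <= `|C| * m ^+ 2 * t ^+ (q.*2 - k).
  move=> kq; near=> t.
  have t0 : 0 < t by near: t; exact: nbhs_right_gt.
  have tk : 0 < t ^+ k by exact: exprn_gt0.
  have h : forall j, `|F (c t) 0 j - (c t *m L) 0 j| <= `|C| * m ^+ 2 * (t ^+ (q.*2)).
    by near: t; exact: H.
  rewrite -mulrBl normrM normfV (gtr0_norm tk) ler_pdivrMr //.
  by rewrite -[leRHS]mulrA -exprD subnK // ltnW.
split.
- have pq0 : (0 < q.*2 - p)%N by rewrite subn_gt0.
  apply: (@squeeze_at_right0 _ _ (fun=> al * L 0 0 + be * L 1 0) _ _ _ pq0).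
    near=> t.
    have t0 : 0 < t by near: t; exact: nbhs_right_gt.
    have tp : t ^+ p != 0 by rewrite expf_neq0 // gt_eqF.
    have -> : al * L 0 0 + be * L 1 0 = (c t *m L) 0 0 / t ^+ p.
      rewrite row2_mulmx; case/orP: pqL => [/eqP <-|/eqP ->]; first by field.
      by field.
    by near: t; exact: bound.
  exact: cvg_cst.
- have kq : (q < q.*2)%N by rewrite -addnn -[X in (X < _)%N]addn0 ltn_add2l.
  have kq0 : (0 < q.*2 - q)%N by rewrite subn_gt0.
  apply: (@squeeze_at_right0 _ _
    (fun t => al * L 0 1 * t ^+ (p - q) + be * L 1 1) _ _ _ kq0).
    near=> t.
    have t0 : 0 < t by near: t; exact: nbhs_right_gt.
    have tq : t ^+ q != 0 by rewrite expf_neq0 // gt_eqF.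
    have -> : al * L 0 1 * t ^+ (p - q) + be * L 1 1 = (c t *m L) 0 1 / t ^+ q.
      have tE : t ^+ p = t ^+ (p - q) * t ^+ q by rewrite -exprD subnK.
      by rewrite row2_mulmx tE; field.
    by near: t; exact: bound.
  apply: cvgD; last exact: cvg_cst.
  apply: cvgM; first exact: cvg_cst.
  have := @exprn_continuous R (p - q) 0; rewrite /continuous_at.
  by move=> cc; apply: cvg_at_right_filter.
Unshelve. all: by end_near. Qed.

End curves.

(** * Transfer of the sign of the determinant *)

Lemma det_mx3 (R : realType) (a b c d e f g h i : R) :
  \det (mx3 [:: [:: a; b; c]; [:: d; e; f]; [:: g; h; i]]) =
  a * (e * i - f * h) - b * (d * i - f * g) + c * (d * h - e * g).
Proof.
rewrite (expand_det_row _ 0) !big_ord_recl big_ord0 /cofactor !det2E !mxE /=.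
ring.
Qed.

Lemma det_jacobian_pullback (R : realType) (Phi : 'rV[R]_2 -> 'rV[R]_2) x :
  pullback Phi (@Omega R) x = @Omega R x -> \det ('J Phi x) = 1.
Proof.
move=> /(congr1 (fun w => w (row2 1 0) (row2 0 1))) H.
have E : @Omega R x (row2 1 0) (row2 0 1) = 1.
  by rewrite /Omega /wedge /dx !row2E; ring.
apply: etrans (esym (mulr1 _)) (etrans _ (etrans H E)).
rewrite -[X in _ * X]E /pullback.
apply: etrans (esym (Omega_mulmx ('J Phi x) x (Phi x) (row2 1 0) (row2 0 1))) _.
by rewrite -!diff_jacobian.
Qed.

Lemma vol_equiv_reflect1P (R : realType) (A : 'rV[R]_2 -> 'M[R]_3) :
  vol_equiv A (reflect1 A) ->
  exists (Phi : 'rV[R]_2 -> 'rV[R]_2) (X : 'rV[R]_2 -> 'M[R]_3),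
    [/\ smooth_germ Phi, Phi 0 = 0, \det ('J Phi 0) = 1 &
     \forall x \near (0 : 'rV[R]_2), X x \in unitmx /\
       A (row2 (- x 0 0) (x 0 1)) = (X x)^T *m A (Phi x) *m X x].
Proof.
move=> [Phi [X [[sPhi [Phi0 _]] [_ uX] AX vol]]]; exists Phi, X; split => //.
  exact: det_jacobian_pullback (nbhs_singleton vol).
apply: filterS (filterI uX AX) => x [ux Ax]; split => //.
rewrite -Ax /reflect1; congr (A _); apply/rowP => j; rewrite !mxE.
have [->//|j0] := eqVneq j 0.
by congr (x 0 _); case: j j0 => [[|[|//]] ?] // _; exact: val_inj.
Qed.

Lemma det_congruence_sign (R : realType) n (X M N : 'M[R]_n) : X \in unitmx ->
  N = X^T *m M *m X ->
  (0 < \det N -> 0 < \det M) /\ (\det N < 0 -> \det M < 0).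
Proof.
rewrite unitmxE unitfE => x0 ->; rewrite !det_mulmx det_tr mulrAC -expr2.
have xx : 0 < \det X ^+ 2 by rewrite exprn_even_gt0.
by rewrite (pmulr_rgt0 _ xx) (pmulr_rlt0 _ xx).
Qed.

(** The minus sign in the first argument comes from [reflect1]. Strict signs are kept in both
    directions because the curves use either one, while limits yield weak inequalities. *)
Definition sign_preserved (R : realType) (F : R -> R -> R)
    (Phi : 'rV[R]_2 -> 'rV[R]_2) (x : 'rV[R]_2) :=
  (0 < F (- x 0 0) (x 0 1) -> 0 < F (Phi x 0 0) (Phi x 0 1)) /\
  (F (- x 0 0) (x 0 1) < 0 -> F (Phi x 0 0) (Phi x 0 1) < 0).

Lemma det_sign_transfer (R : realType) (A : 'rV[R]_2 -> 'M[R]_3)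
    (F : R -> R -> R) :
  (forall x : 'rV[R]_2, \det (A x) = - F (x 0 0) (x 0 1)) -> vol_equiv A (reflect1 A) ->
  exists Phi : 'rV[R]_2 -> 'rV[R]_2,
    [/\ smooth_germ Phi, Phi 0 = 0, \det ('J Phi 0) = 1 &
     \forall x \near (0 : 'rV[R]_2), sign_preserved F Phi x].
Proof.
move=> AF /vol_equiv_reflect1P[Phi [X [sPhi Phi0 dPhi H]]].
exists Phi; split => //; apply: filterS H => x [ux /(det_congruence_sign ux)].
by rewrite /sign_preserved !AF !row2E !oppr_gt0 !oppr_lt0 => -[h1 h2]; split.
Qed.

Lemma near_right0_pos (R : realType) (k : R) n : (0 < n)%N ->
  \forall t \near (0 : R)^'+, 0 < 1 + k * t ^+ n.
Proof.
move=> n0; have c : 1 + k * t ^+ n @[t --> (0 : R)^'+] --> 1 + k * 0.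
  apply: cvgD; first exact: cvg_cst.
  by apply: cvgM; [exact: cvg_cst|exact: expr_at_right0].
rewrite mulr0 addr0 in c.
have := c [set z : R | 0 < z]; apply; exact: lt_nbhsr ltr01.
Qed.

Lemma affine_ge0_slope_eq0 (R : realType) (a b : R) :
  (forall s, 0 <= a + s * b) -> b = 0.
Proof.
move=> H; apply/eqP; apply: contraT => b0.
have := H ((- a - 1) / b); rewrite divfK // addrA subrr sub0r.
by rewrite ler0N1.
Qed.

Lemma affine_ge0_slope_ge0 (R : realType) (a b : R) :
  (forall s, 0 <= s -> 0 <= a + s * b) -> 0 <= b.
Proof.
move=> H; rewrite leNgt; apply/negP => b0.
have a0 : 0 <= a by have := H 0 (lexx 0); rewrite mul0r addr0.
have s0 : 0 <= (- a - 1) / b.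
  by rewrite ler_ndivlMr // mul0r; lra.
have := H _ s0; rewrite divfK ?lt_eqF // addrA subrr sub0r.
by rewrite ler0N1.
Qed.

Section weighted_limits.
Context {R : realType}.
Implicit Types (A B : R -> R).

Lemma cvg_pow_at_right0 A (l : R) n : A t @[t --> (0 : R)^'+] --> l ->
  A t ^+ n @[t --> (0 : R)^'+] --> l ^+ n.
Proof.
by move=> Al; exact: (cvg_comp _ _ Al (@exprn_continuous R n l)).
Qed.

Lemma cvg_monomial_at_right0 A B (a b k : R) i j n :
  A t @[t --> (0 : R)^'+] --> a -> B t @[t --> (0 : R)^'+] --> b ->
  k * A t ^+ i * B t ^+ j * t ^+ n @[t --> (0 : R)^'+]
    --> k * a ^+ i * b ^+ j * 0 ^+ n.
Proof.
move=> Aa Bb; apply: cvgM; last first.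
  by apply: (@cvg_pow_at_right0 id); apply: cvg_at_right_filter; exact: cvg_id.
apply: cvgM; last exact: cvg_pow_at_right0.
by apply: cvgM; [exact: cvg_cst|exact: cvg_pow_at_right0].
Qed.

Lemma cvg_add_at_right0 A B (a b : R) :
  A t @[t --> (0 : R)^'+] --> a -> B t @[t --> (0 : R)^'+] --> b ->
  A t + B t @[t --> (0 : R)^'+] --> a + b.
Proof. by move=> Aa Bb; exact: cvgD. Qed.

End weighted_limits.

Arguments cvg_monomial_at_right0 {R A B a b} k (i j n)%_N.

(* The second curve follows the weights (3, 2) of [x1^3 + e x1 x2^3]. *)
Lemma no_sign_preserving_E7 (R : realType) (e : R)
    (Phi : 'rV[R]_2 -> 'rV[R]_2) (F := fun a b : R => a ^+ 3 + e * a * b ^+ 3) :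
  e ^+ 2 = 1 -> smooth_germ Phi -> Phi 0 = 0 -> \det ('J Phi 0) = 1 ->
  ~ (\forall x \near (0 : 'rV[R]_2), sign_preserved F Phi x).
Proof.
move=> ee sPhi Phi0 detL H.
(* On the line (-t, s t) the reflected value is t^3 (1 + e s^3 t) > 0, and on the image the cube of
   the first coordinate dominates. As s runs over all reals, the lower left entry must vanish. *)
have step1 s : 0 <= - 'J Phi 0 0 0 + s * 'J Phi 0 1 0.
  have [c0 c1] := curve_cvg (-1) s (p := 1%N) (q := 1%N) sPhi Phi0
    isT isT isT isT.
  move: c0 c1; rewrite mulN1r; set l0 := - _ + _; set l1 := _ + _ => c0 c1.
  pose c (t : R) := row2 (-1 * t ^+ 1) (s * t ^+ 1).
  have Hc : \forall t \near (0 : R)^'+, sign_preserved F Phi (c t).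
    exact: (curve_at_right0 (-1) s (p := 1%N) (q := 1%N) isT isT H).
  have cg := cvg_add_at_right0 (cvg_monomial_at_right0 1 3 0 0 c0 c1)
    (cvg_monomial_at_right0 e 1 3 1 c0 c1).
  have : 0 <= l0 ^+ 3.
    suff : 0 <= 1 * l0 ^+ 3 * l1 ^+ 0 * 0 ^+ 0 + e * l0 ^+ 1 * l1 ^+ 3 * 0 ^+ 1.
      by rewrite !expr0 expr1 mulr0 addr0 !mulr1 mul1r.
    apply: (cvg_at_right0_ge0 cg); near=> t.
    have t0 : 0 < t by near: t; exact: nbhs_right_gt.
    have tn : t != 0 by rewrite gt_eqF.
    have [St _] : sign_preserved F Phi (c t) by near: t; exact: Hc.
    have pos : 0 < 1 + (e * s ^+ 3) * t ^+ 1.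
      by near: t; exact: near_right0_pos.
    have {St} : 0 < F (Phi (c t) 0 0) (Phi (c t) 0 1).
      apply: St; rewrite /c !row2E /F.
      have -> : (- (-1 * t ^+ 1)) ^+ 3 + e * - (-1 * t ^+ 1) * (s * t ^+ 1) ^+ 3 =
        t ^+ 3 * (1 + (e * s ^+ 3) * t ^+ 1) by ring.
      by rewrite mulr_gt0 // exprn_gt0.
    rewrite /F -/(c t); move: (Phi (c t) 0 0) (Phi (c t) 0 1) => y0 y1 yF.
    have -> : 1 * (y0 / t ^+ 1) ^+ 3 * (y1 / t ^+ 1) ^+ 0 * t ^+ 0 +
      e * (y0 / t ^+ 1) ^+ 1 * (y1 / t ^+ 1) ^+ 3 * t ^+ 1 =
      (y0 ^+ 3 + e * y0 * y1 ^+ 3) / t ^+ 3 by field.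
    by rewrite divr_ge0 ?exprn_ge0 // ltW.
  by rewrite exprn_odd_ge0.
have L10 : 'J Phi 0 1 0 = 0 := affine_ge0_slope_eq0 step1.
have L00 : 'J Phi 0 0 0 <= 0.
  by have := step1 0; rewrite mul0r addr0 oppr_ge0.
(* At the reflected point (t^3, -2 e t^2) the value is t^9 (1 - 8 e^4) = -7 t^9; the factor e in the
   curve makes the sign of e disappear. With diagonal entries x, y of D Phi(0) and xy = 1, the limit
   of -F / t^9 on the image is x^3 - 8 y^2, negative for x < 0. *)
have [c0 c1] : (_ /\ _) := curve_cvg (-1) (- (2 * e)) (p := 3%N) (q := 2%N)
  sPhi Phi0 isT isT isT (introT eqP L10).
pose c (t : R) := row2 (-1 * t ^+ 3) (- (2 * e) * t ^+ 2).
have Hc : \forall t \near (0 : R)^'+, sign_preserved F Phi (c t).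
  exact: (curve_at_right0 (-1) (- (2 * e)) (p := 3%N) (q := 2%N) isT isT H).
move: c0 c1; set l0 := _ + _; set l1 := _ + _ => c0 c1.
have cg := cvg_add_at_right0 (cvg_monomial_at_right0 (-1) 3 0 0 c0 c1)
  (cvg_monomial_at_right0 (- e) 1 3 0 c0 c1).
have : 0 <= -1 * l0 ^+ 3 * l1 ^+ 0 * 0 ^+ 0 + - e * l0 ^+ 1 * l1 ^+ 3 * 0 ^+ 0.
  apply: (cvg_at_right0_ge0 cg); near=> t.
  have t0 : 0 < t by near: t; exact: nbhs_right_gt.
  have tn : t != 0 by rewrite gt_eqF.
  have [_ St] : sign_preserved F Phi (c t) by near: t; exact: Hc.
  have {St} : F (Phi (c t) 0 0) (Phi (c t) 0 1) < 0.
    apply: St; rewrite /c !row2E /F.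
    have -> : (- (-1 * t ^+ 3)) ^+ 3 +
        e * - (-1 * t ^+ 3) * (- (2 * e) * t ^+ 2) ^+ 3 =
      - (t ^+ 9 * (8 * (e ^+ 2) ^+ 2 - 1)) by ring.
    rewrite ee expr1n mulr1 oppr_lt0 mulr_gt0 ?exprn_gt0 //; lra.
  rewrite /F -/(c t); move: (Phi (c t) 0 0) (Phi (c t) 0 1) => y0 y1 yF.
  have -> : -1 * (y0 / t ^+ 3) ^+ 3 * (y1 / t ^+ 2) ^+ 0 * t ^+ 0 +
    - e * (y0 / t ^+ 3) ^+ 1 * (y1 / t ^+ 2) ^+ 3 * t ^+ 0 =
    (- (y0 ^+ 3 + e * y0 * y1 ^+ 3)) / t ^+ 9 by field.
  by rewrite divr_ge0 ?exprn_ge0 // oppr_ge0 ltW.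
rewrite /l0 /l1 L10.
move: detL; rewrite det2E L10 mulr0 subr0.
move: ('J Phi 0 0 0) L00 ('J Phi 0 1 1) ('J Phi 0 0 1) => x L00 y z xy.
have -> : -1 * (-1 * x + - (2 * e) * 0) ^+ 3 *
   (-1 * z * 0 ^+ (3 - 2) + - (2 * e) * y) ^+ 0 * 0 ^+ 0 +
  - e * (-1 * x + - (2 * e) * 0) ^+ 1 *
   (-1 * z * 0 ^+ (3 - 2) + - (2 * e) * y) ^+ 3 * 0 ^+ 0 =
  x ^+ 3 - 8 * (e ^+ 2) ^+ 2 * (x * y) * y ^+ 2.
  by rewrite subSnn; ring.
rewrite ee xy expr1n !mulr1 => h.
have x0 : x < 0.
  by rewrite lt_neqAle L00 andbT; apply/eqP => x0; move: xy; rewrite x0 mul0r => /eqP; rewrite eq_sym oner_eq0.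
have x3 : x ^+ 3 < 0 by rewrite exprn_odd_lt0.
have y2 : 0 <= y ^+ 2 by exact: sqr_ge0.
by move: h x3 y2; set a := x ^+ 3; set b := y ^+ 2; lra.
Unshelve. all: by end_near. Qed.

(* The second curve follows the weights (5, 3) of [x1^3 + x2^5]. *)
Lemma no_sign_preserving_E8 (R : realType)
    (Phi : 'rV[R]_2 -> 'rV[R]_2) (F := fun a b : R => a ^+ 3 + b ^+ 5) :
  smooth_germ Phi -> Phi 0 = 0 -> \det ('J Phi 0) = 1 ->
  ~ (\forall x \near (0 : 'rV[R]_2), sign_preserved F Phi x).
Proof.
move=> sPhi Phi0 detL H.
have step1 s : 0 <= - 'J Phi 0 0 0 + s * 'J Phi 0 1 0.
  have [c0 c1] := curve_cvg (-1) s (p := 1%N) (q := 1%N) sPhi Phi0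
    isT isT isT isT.
  move: c0 c1; rewrite mulN1r; set l0 := - _ + _; set l1 := _ + _ => c0 c1.
  pose c (t : R) := row2 (-1 * t ^+ 1) (s * t ^+ 1).
  have Hc : \forall t \near (0 : R)^'+, sign_preserved F Phi (c t).
    exact: (curve_at_right0 (-1) s (p := 1%N) (q := 1%N) isT isT H).
  have cg := cvg_add_at_right0 (cvg_monomial_at_right0 1 3 0 0 c0 c1)
    (cvg_monomial_at_right0 1 0 5 2 c0 c1).
  have : 0 <= l0 ^+ 3.
    suff : 0 <= 1 * l0 ^+ 3 * l1 ^+ 0 * 0 ^+ 0 + 1 * l0 ^+ 0 * l1 ^+ 5 * 0 ^+ 2.
      by rewrite !expr0 expr0n /= mulr0 addr0 !mulr1 mul1r.
    apply: (cvg_at_right0_ge0 cg); near=> t.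
    have t0 : 0 < t by near: t; exact: nbhs_right_gt.
    have tn : t != 0 by rewrite gt_eqF.
    have [St _] : sign_preserved F Phi (c t) by near: t; exact: Hc.
    have pos : 0 < 1 + s ^+ 5 * t ^+ 2.
      by near: t; exact: near_right0_pos.
    have {St} : 0 < F (Phi (c t) 0 0) (Phi (c t) 0 1).
      apply: St; rewrite /c !row2E /F.
      have -> : (- (-1 * t ^+ 1)) ^+ 3 + (s * t ^+ 1) ^+ 5 =
        t ^+ 3 * (1 + s ^+ 5 * t ^+ 2) by ring.
      by rewrite mulr_gt0 // exprn_gt0.
    rewrite /F -/(c t); move: (Phi (c t) 0 0) (Phi (c t) 0 1) => y0 y1 yF.
    have -> : 1 * (y0 / t ^+ 1) ^+ 3 * (y1 / t ^+ 1) ^+ 0 * t ^+ 0 +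
      1 * (y0 / t ^+ 1) ^+ 0 * (y1 / t ^+ 1) ^+ 5 * t ^+ 2 =
      (y0 ^+ 3 + y1 ^+ 5) / t ^+ 3 by field.
    by rewrite divr_ge0 ?exprn_ge0 // ltW.
  by rewrite exprn_odd_ge0.
have L10 : 'J Phi 0 1 0 = 0 := affine_ge0_slope_eq0 step1.
have L00 : 'J Phi 0 0 0 <= 0.
  by have := step1 0; rewrite mul0r addr0 oppr_ge0.
(* The curve (0, t^3) is fixed by the reflection and has F = t^15 > 0, so the lower right entry is
   nonnegative. The product of the diagonal entries is then at most 0, but it equals the determinant
   1. *)
have [c0 c1] : (_ /\ _) := curve_cvg 0 1 (p := 5%N) (q := 3%N)
  sPhi Phi0 isT isT isT (introT eqP L10).
pose c (t : R) := row2 (0 * t ^+ 5) (1 * t ^+ 3).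
have Hc : \forall t \near (0 : R)^'+, sign_preserved F Phi (c t).
  exact: (curve_at_right0 0 1 (p := 5%N) (q := 3%N) isT isT H).
move: c0 c1; set l0 := _ + _; set l1 := _ + _ => c0 c1.
have cg := cvg_add_at_right0 (cvg_monomial_at_right0 1 3 0 0 c0 c1)
  (cvg_monomial_at_right0 1 0 5 0 c0 c1).
have : 0 <= 1 * l0 ^+ 3 * l1 ^+ 0 * 0 ^+ 0 + 1 * l0 ^+ 0 * l1 ^+ 5 * 0 ^+ 0.
  apply: (cvg_at_right0_ge0 cg); near=> t.
  have t0 : 0 < t by near: t; exact: nbhs_right_gt.
  have tn : t != 0 by rewrite gt_eqF.
  have [St _] : sign_preserved F Phi (c t) by near: t; exact: Hc.
  have {St} : 0 < F (Phi (c t) 0 0) (Phi (c t) 0 1).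
    apply: St; rewrite /c !row2E /F.
    have -> : (- (0 * t ^+ 5)) ^+ 3 + (1 * t ^+ 3) ^+ 5 = t ^+ 15 by ring.
    exact: exprn_gt0.
  rewrite /F -/(c t); move: (Phi (c t) 0 0) (Phi (c t) 0 1) => y0 y1 yF.
  have -> : 1 * (y0 / t ^+ 5) ^+ 3 * (y1 / t ^+ 3) ^+ 0 * t ^+ 0 +
    1 * (y0 / t ^+ 5) ^+ 0 * (y1 / t ^+ 3) ^+ 5 * t ^+ 0 =
    (y0 ^+ 3 + y1 ^+ 5) / t ^+ 15 by field.
  by rewrite divr_ge0 ?exprn_ge0 // ltW.
rewrite /l0 /l1 L10.
move: detL; rewrite det2E L10 mulr0 subr0.
move: ('J Phi 0 0 0) L00 ('J Phi 0 1 1) ('J Phi 0 0 1) => x L00 y z xy.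
have -> : 1 * (0 * x + 1 * 0) ^+ 3 *
   (0 * z * 0 ^+ (5 - 3) + 1 * y) ^+ 0 * 0 ^+ 0 +
  1 * (0 * x + 1 * 0) ^+ 0 *
   (0 * z * 0 ^+ (5 - 3) + 1 * y) ^+ 5 * 0 ^+ 0 = y ^+ 5 by ring.
rewrite exprn_odd_ge0 // => y0.
by have := mulr_le0_ge0 L00 y0; rewrite xy ler10.
Unshelve. all: by end_near. Qed.

(** * Case 5: semidefiniteness *)

Lemma congruence_inv (R : realType) n (X M N : 'M[R]_n) : X \in unitmx ->
  N = X^T *m M *m X -> M = (invmx X)^T *m N *m invmx X.
Proof.
move=> uX ->; rewrite !mulmxA -trmx_mul mulmxV // trmx1 mul1mx.
by rewrite mulmxK.
Qed.

(** The two inequalities on [x] make the reflected germ positive semidefinite. Congruence preserves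
    this, and the coordinates of [Phi x] are diagonal entries of the germ at [Phi x]. *)
Lemma germ5_diag_ge0 (R : realType) l (Phi : 'rV[R]_2 -> 'rV[R]_2)
    (X : 'M[R]_3) (x : 'rV[R]_2) : X \in unitmx ->
  germ5 l (row2 (- x 0 0) (x 0 1)) = X^T *m germ5 l (Phi x) *m X ->
  0 <= x 0 1 -> x 0 1 ^+ l <= - x 0 0 ->
  0 <= Phi x 0 0 /\ 0 <= Phi x 0 1.
Proof.
move=> uX /(congruence_inv uX); set Z := invmx X => E b0 ab.
have q0 : 0 <= x 0 1 ^+ l by exact: exprn_ge0.
have quad i : 0 <= germ5 l (Phi x) i i.
  rewrite E !mxE !big_ord_recl !big_ord0 !mxE !big_ord_recl !big_ord0 !mxE /=.
  move: q0 ab b0; set q := x 0 1 ^+ l; set a := - x 0 0; set b := x 0 1.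
  move: (Z _ _) (Z _ _) (Z _ _) => z2 z1 z0 q0 ab b0.
  (* The quadratic form is a sum of nonnegative terms, (a - q)(z0^2 + z1^2) + q (z0 + z1)^2 + b
     z2^2. *)
  have h0 : 0 <= (a - q) * z0 ^+ 2 by rewrite mulr_ge0 ?sqr_ge0 ?subr_ge0.
  have h1 : 0 <= (a - q) * z1 ^+ 2 by rewrite mulr_ge0 ?sqr_ge0 ?subr_ge0.
  have h2 : 0 <= q * (z0 + z1) ^+ 2 by rewrite mulr_ge0 ?sqr_ge0.
  have h3 : 0 <= b * z2 ^+ 2 by rewrite mulr_ge0 ?sqr_ge0.
  have := addr_ge0 (addr_ge0 h0 h1) (addr_ge0 h2 h3).
  move=> /le_trans; apply; rewrite le_eqVlt; apply/orP; left; apply/eqP; ring.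
split; first by have := quad 0; rewrite !mxE.
by have := quad (inord 2); rewrite !mxE inordK.
Qed.

Lemma germ5_det (R : realType) l (x : 'rV[R]_2) :
  \det (germ5 l x) = - (x 0 1 * (x 0 1 ^+ (l.*2) - x 0 0 ^+ 2)).
Proof. by rewrite /germ5 det_mx3 -addnn exprD; ring. Qed.

(** Positivity fixes the signs of all entries of D Phi(0): the first row is nonpositive, the second
    nonnegative. As the determinant is 1, both off-diagonal entries are nonzero. The sign of the
    determinant of the germ then makes an affine function of s with nonzero slope vanish for all
    small s > 0. *)
Lemma germ5_not_vol_equiv (R : realType) l : (2 <= l)%N ->
  ~ vol_equiv (@germ5 R l) (reflect1 (germ5 l)).
Proof.
move=> l2 vol.
have [Phi [X [sPhi Phi0 detL H]]] := vol_equiv_reflect1P vol.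
pose F (a b : R) := b * (b ^+ l.*2 - a ^+ 2).
have lE : l.*2 = (l.*2 - 2).+2 by lia.
have l0 : (0 < l.*2 - 2)%N by lia.
have HS : \forall x \near (0 : 'rV[R]_2), sign_preserved F Phi x.
  apply: filterS H => x [ux /(det_congruence_sign ux)].
  rewrite !germ5_det !row2E /sign_preserved /F !oppr_gt0 !oppr_lt0 => -[h1 h2].
  by split.
have step1 s : 0 <= s -> 0 <= - 'J Phi 0 0 0 + s * 'J Phi 0 1 0 /\
    0 <= - 'J Phi 0 0 1 + s * 'J Phi 0 1 1.
  move=> s0.
  have [c0 c1] := curve_cvg (-1) s (p := 1%N) (q := 1%N) sPhi Phi0
    isT isT isT isT.
  move: c0 c1; rewrite !mulN1r subnn expr0 mulr1 => c0 c1.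
  pose c (t : R) := row2 (-1 * t ^+ 1) (s * t ^+ 1).
  have Hc : \forall t \near (0 : R)^'+, X (c t) \in unitmx /\
      germ5 l (row2 (- (c t) 0 0) ((c t) 0 1)) =
      (X (c t))^T *m germ5 l (Phi (c t)) *m X (c t).
    exact: (curve_at_right0 (-1) s (p := 1%N) (q := 1%N) isT isT H).
  have Hd : \forall t \near (0 : R)^'+,
      0 <= Phi (c t) 0 0 /\ 0 <= Phi (c t) 0 1.
    near=> t.
    have t0 : 0 < t by near: t; exact: nbhs_right_gt.
    have [ut Et] : X (c t) \in unitmx /\
      germ5 l (row2 (- (c t) 0 0) ((c t) 0 1)) =
      (X (c t))^T *m germ5 l (Phi (c t)) *m X (c t) by near: t; exact: Hc.
    apply: (germ5_diag_ge0 ut Et); rewrite /c !row2E expr1.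
      by rewrite mulr_ge0 // ltW.
    rewrite mulN1r opprK exprMn.
    (* Since l >= 2, (s t)^l <= t for small t > 0, so the curve stays in the region where the
       reflected germ is semidefinite. *)
    have pos : 0 < 1 + - s ^+ l * t ^+ l.-1.
      by near: t; apply: near_right0_pos; lia.
    have -> : t ^+ l = t * t ^+ l.-1 by rewrite -exprS prednK //; lia.
    rewrite mulrCA -[leRHS]mulr1 ler_pM2l //.
    by move: pos; rewrite mulNr subr_gt0 => /ltW.
  split; [apply: (cvg_at_right0_ge0 c0)|apply: (cvg_at_right0_ge0 c1)].
  - near=> t.
    have t0 : 0 < t by near: t; exact: nbhs_right_gt.
    have [h _] : 0 <= Phi (c t) 0 0 /\ 0 <= Phi (c t) 0 1 by near: t; exact: Hd.
    by rewrite divr_ge0 // exprn_ge0 // ltW.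
  - near=> t.
    have t0 : 0 < t by near: t; exact: nbhs_right_gt.
    have [_ h] : 0 <= Phi (c t) 0 0 /\ 0 <= Phi (c t) 0 1 by near: t; exact: Hd.
    by rewrite divr_ge0 // exprn_ge0 // ltW.
have L00 : 'J Phi 0 0 0 <= 0.
  by have [] := step1 0 (lexx 0); rewrite mul0r addr0 oppr_ge0.
have L01 : 'J Phi 0 0 1 <= 0.
  by have [_] := step1 0 (lexx 0); rewrite mul0r addr0 oppr_ge0.
have L10 : 0 <= 'J Phi 0 1 0.
  by apply: (@affine_ge0_slope_ge0 _ (- 'J Phi 0 0 0)) => s /step1[].
have L11 : 0 <= 'J Phi 0 1 1.
  by apply: (@affine_ge0_slope_ge0 _ (- 'J Phi 0 0 1)) => s /step1[].
(* On (t, s t) the leading part of [F] is -s t^3, since x2^(2l) is of higher order than x1^2; on the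
   image, the leading part of -F is x1^2 x2. *)
have step2 s : 0 < s ->
    0 <= ('J Phi 0 0 1 + s * 'J Phi 0 1 1) * ('J Phi 0 0 0 + s * 'J Phi 0 1 0) ^+ 2.
  move=> s0.
  have [c0 c1] := curve_cvg 1 s (p := 1%N) (q := 1%N) sPhi Phi0
    isT isT isT isT.
  move: c0 c1; rewrite !mul1r subnn expr0 mulr1.
  set k0 := _ + _; set k1 := _ + _ => c0 c1.
  pose c (t : R) := row2 (1 * t ^+ 1) (s * t ^+ 1).
  have Hc : \forall t \near (0 : R)^'+, sign_preserved F Phi (c t).
    exact: (curve_at_right0 1 s (p := 1%N) (q := 1%N) isT isT HS).
  have cg := cvg_add_at_right0 (cvg_monomial_at_right0 1 2 1 0 c0 c1)
    (cvg_monomial_at_right0 (-1) 0 (l.*2.+1) (l.*2 - 2) c0 c1).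
  suff : 0 <= 1 * k0 ^+ 2 * k1 ^+ 1 * 0 ^+ 0 +
      -1 * k0 ^+ 0 * k1 ^+ l.*2.+1 * 0 ^+ (l.*2 - 2).
    rewrite [0 ^+ (l.*2 - 2)]expr0n gtn_eqF // mulr0 addr0.
    by rewrite expr1 expr0 mulr1 mul1r mulrC.
  apply: (cvg_at_right0_ge0 cg); near=> t.
  have t0 : 0 < t by near: t; exact: nbhs_right_gt.
  have tn : t != 0 by rewrite gt_eqF.
  have [_ St] : sign_preserved F Phi (c t) by near: t; exact: Hc.
  have pos : 0 < 1 + - s ^+ l.*2 * t ^+ (l.*2 - 2).
    by near: t; exact: near_right0_pos.
  have {St} : F (Phi (c t) 0 0) (Phi (c t) 0 1) < 0.
    apply: St; rewrite /c !row2E /F !mul1r !expr1 exprMn.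
    have tE : t ^+ l.*2 = t ^+ 2 * t ^+ (l.*2 - 2) by rewrite -exprD; congr (_ ^+ _); lia.
    have -> : s * t * (s ^+ l.*2 * t ^+ l.*2 - (- t) ^+ 2) =
       - (s * t ^+ 3 * (1 + - s ^+ l.*2 * t ^+ (l.*2 - 2))) by rewrite tE; ring.
    by rewrite oppr_lt0 !mulr_gt0 // exprn_gt0.
  rewrite /F -/(c t); move: (Phi (c t) 0 0) (Phi (c t) 0 1) => y0 y1 yF.
  have -> : 1 * (y0 / t ^+ 1) ^+ 2 * (y1 / t ^+ 1) ^+ 1 * t ^+ 0 +
      -1 * (y0 / t ^+ 1) ^+ 0 * (y1 / t ^+ 1) ^+ l.*2.+1 * t ^+ (l.*2 - 2) =
      (- (y1 * (y1 ^+ l.*2 - y0 ^+ 2))) / t ^+ 3.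
    have [k kE] : exists k, l.*2 = k.+2 by exists (l.*2 - 2)%N; exact: lE.
    have kE' : (l.*2 - 2)%N = k by rewrite kE subn2.
    rewrite kE' kE !expr1 !expr_div_n !exprS !expr0.
    have : t ^+ k != 0 by rewrite expf_neq0.
    move: (t ^+ k) (y1 ^+ k) => tk yk tk0.
    by field; rewrite ?tk0 ?tn.
  by rewrite divr_ge0 ?exprn_ge0 // ?oppr_ge0 ltW.
move: detL; rewrite det2E.
move: L00 L01 L10 L11 step2.
move: ('J Phi 0 0 0) ('J Phi 0 0 1) ('J Phi 0 1 0) ('J Phi 0 1 1).
move=> x y z w x0 y0 z0 w0 step2 D.
have xw : x * w <= 0 by exact: mulr_le0_ge0.
have yz : y * z <= -1 by lra.
have yn : y < 0.
  by rewrite lt_neqAle y0 andbT; apply/eqP => yE; move: yz; rewrite yE mul0r; lra.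
have zn : 0 < z.
  by rewrite lt_neqAle z0 andbT eq_sym; apply/eqP => zE; move: yz; rewrite zE mulr0; lra.
have w1 : 0 < w + 1 by lra.
(* Chosen so that y + r w <= y / 2 < 0 for all 0 < r <= s; adding 1 to w avoids a zero
   denominator. *)
pose s := - y / (w + 1) / 2.
have s0 : 0 < s by rewrite !divr_gt0 // oppr_gt0.
have sE : s * (w + 1) = - y / 2 by rewrite /s; field; rewrite gt_eqF.
have key r : 0 < r -> r <= s -> x + r * z = 0.
  move=> r0 rs; have h := step2 r r0.
  have neg : y + r * w < 0.
    have : r * w <= s * (w + 1) by apply: ler_pM => //; [exact: ltW|lra].
    by rewrite sE; lra.
  have : (x + r * z) ^+ 2 <= 0 by rewrite -(nmulr_rge0 _ neg).
  by rewrite le_eqVlt ltNge sqr_ge0 orbF sqrf_eq0 => /eqP.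
(* An affine function of r with slope z > 0 cannot vanish at both s and s / 2. *)
have k1 := key s s0 (lexx s).
have s2 : 0 < s / 2 by rewrite divr_gt0.
have k2 : x + s / 2 * z = 0 by apply: key => //; lra.
have sz : 0 < s * z by rewrite mulr_gt0.
have k3 : s / 2 * z = s * z / 2 by ring.
by move: k1 k2 sz; rewrite k3; move: (s * z) => u; lra.
Unshelve. all: by end_near. Qed.

Lemma split_not_vol_equiv (R : realType) (A : 'rV[R]_2 -> 'M[R]_3) :
  split_germ A -> ~ vol_equiv A (reflect1 A).
Proof.
case=> [l l2||s||]; first exact: germ5_not_vol_equiv.
- have D (x : 'rV[R]_2) : \det (germ7 x) =
      - (x 0 0 ^+ 3 + 1 * x 0 0 * x 0 1 ^+ 3) by rewrite /germ7 det_mx3; ring.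
  move=> /(det_sign_transfer (F := fun a b => a ^+ 3 + 1 * a * b ^+ 3) D).
  by move=> [Phi []]; apply: no_sign_preserving_E7; rewrite expr1n.
- have D (x : 'rV[R]_2) : \det (germ8 s x) =
      - (x 0 0 ^+ 3 + - sgn R s * x 0 0 * x 0 1 ^+ 3).
    by rewrite /germ8 det_mx3; ring.
  move=> /(det_sign_transfer (F := fun a b => a ^+ 3 + - sgn R s * a * b ^+ 3) D).
  move=> [Phi []]; apply: no_sign_preserving_E7.
  by rewrite sqrrN /sgn sqrr_sign.
- have D (x : 'rV[R]_2) : \det (germ9 x) = - (x 0 0 ^+ 3 + x 0 1 ^+ 5).
    by rewrite /germ9 det_mx3; ring.
  move=> /(det_sign_transfer (F := fun a b => a ^+ 3 + b ^+ 5) D).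
  by move=> [Phi []]; apply: no_sign_preserving_E8.
- have D (x : 'rV[R]_2) : \det (germ10 x) = - (x 0 0 ^+ 3 + x 0 1 ^+ 5).
    by rewrite /germ10 det_mx3; ring.
  move=> /(det_sign_transfer (F := fun a b => a ^+ 3 + b ^+ 5) D).
  by move=> [Phi []]; apply: no_sign_preserving_E8.
Qed.

Theorem mainTheorem11 (R : realType) :
  (forall A : 'rV[R]_2 -> 'M[R]_3, unsplit_germ A ->
     forall B : 'rV[R]_2 -> 'M[R]_3, sym_germ B ->
       G_equiv A B -> vol_equiv A B)
  /\
  (forall A : 'rV[R]_2 -> 'M[R]_3, split_germ A ->
     [/\ G_equiv A (reflect1 A),
         ~ vol_equiv A (reflect1 A)
       & forall B : 'rV[R]_2 -> 'M[R]_3, sym_germ B ->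
           G_equiv A B -> vol_equiv A B \/ vol_equiv (reflect1 A) B]).
Proof.
split=> [A uA B _|A sA]; first exact: unsplit_vol_equiv.
split=> [||B _]; first exact: G_equiv_reflect1.
- exact: split_not_vol_equiv.
- exact: split_vol_equiv.
Qed.
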